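(* Let $\partial$ be a generator on $\mathbf N$, let $\eta$ be a Poisson process on $\mathbb X$ with locally finite intensity measure $\lambda$, and suppose that $\partial\eta$ is a.s. finite or, more generally, that the strong Markov property $$\mathbb P(\eta_{[\eta]}\in\cdot\mid\partial\eta)=\Pi_{\lambda_{[\eta]}}(\cdot)\quad\text{a.s.}$$ holds. Let $f\in L^1(\lambda)$, $F:=\int f(x)\,\lambda(dx)$, $F^*:=\int f(x)\,\eta(dx)$ and $\hat F:=\mathbb E[F^*\mid\partial\eta]$. Then $$\hat F-F=\int f(z)H_z(\eta-\delta_z)\,\eta(dz)-\int f(z)H_z(\eta)\,\lambda(dz)\qquad\text{a.s.}$$
   Context: $(\mathbb X,\mathcal X)$ is a Borel space with a localising ring $\mathcal X_0\subset\mathcal X$: a ring of sets such that (a) $B\in\mathcal X_0$, $C\in\mathcal X$ imply $B\cap C\in\mathcal X_0$; (b) there is an increasing sequence $B_n\in\mathcal X_0$, $n\in\mathbb N$, with union $\mathbb X$ such that each set in $\mathcal X_0$ has the form $C\cap B_n$ for some $C\in\mathcal X$, $n\in\mathbb N$. A measure is locally finite if it is finite on $\mathcal X_0$. $\mathbf N$ is the set of all measures $\mu$ on $\mathbb X$ with $\mu(B)\in\{0,1,2,\dots\}$ for all $B\in\mathcal X_0$, equipped with the smallest $\sigma$-field making $\mu\mapsto\mu(B)$ measurable for all $B\in\mathcal X$. Write $\operatorname{supp}\mu=\{x:\mu(\{x\})>0\}$; $x\in\mu$ means $x\in\operatorname{supp}\mu$; $\delta_x$ is the Dirac measure at $x$;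 $\nu_B:=\nu(\cdot\cap B)$; $\nu'\le\nu$ means $\nu'(B)\le\nu(B)$ for all $B\in\mathcal X$. A generator is a measurable map $\partial:\mathbf N\to\mathbf N$ such that: (thinning) $\partial\mu\le\mu$ for all $\mu$; (additivity) $\partial(\mu+\delta_x)=\partial\mu+\delta_x$ for all $\mu\in\mathbf N$, $x\in\partial\mu$; (idempotency) $\partial(\partial\mu+\mu')=\partial\mu$ for all $\mu,\mu'\in\mathbf N$ with $\mu'\le\mu-\partial\mu$; (consistency) if $\mu'\le\mu$ and $\partial\mu=\partial\mu'$, then $\partial(\mu+\psi)=\partial(\mu'+\psi)$ for all $\psi\in\mathbf N$. Put $H_x(\mu):=\mathbf 1\{\partial(\mu+\delta_x)\ne\partial\mu\}$; the hull operator is $[\mu]:=\{x\in\mathbb X:H_x(\mu)=0\}$. A Poisson process with intensity measure $\lambda$ is a random element $\eta$ of $\mathbf N$ with independent Poisson distributed increments and $\mathbb E\eta(B)=\lambda(B)$; its distribution is denoted $\Pi_\lambda$. *)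

(* Defs.v *)
From HB Require Import structures.
From mathcomp Require Import all_boot all_order all_algebra.
From mathcomp Require Import all_classical all_reals all_analysis.
(* all_analysis does not export the measurable structure of \bar R *)
From mathcomp Require Import measurable_realfun.

Set Implicit Arguments.
Unset Strict Implicit.
Unset Printing Implicit Defensive.
Import Order.TTheory GRing.Theory Num.Theory.
Import numFieldNormedType.Exports.

Local Open Scope classical_set_scope.
Local Open Scope ring_scope.
Local Open Scope ereal_scope.

(* X is isomorphic, as a measurable space, to a Borel subset of [0, 1] *)
Definition borel_space (R : realType) d (X : measurableType d) : Prop :=
  exists phi : X -> R, [/\ measurable_fun [set: X] phi, injective phi,
    range phi `<=` `[0%R, 1%R]
    & forall B, measurable B -> measurable (phi @` B)].

Record localising_ring d (X : measurableType d) := LocalisingRing {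
  lring :> set X -> Prop;
  lring_measurable : lring `<=` measurable;
  lring_setring : setring lring;
  lring_setI : forall B C, lring B -> measurable C -> lring (B `&` C);
  lring_exhaustion : exists B : (set X)^nat,
    [/\ forall n, lring (B n), forall n, B n `<=` B n.+1,
        \bigcup_n B n = setT
      & forall A, lring A -> exists C n, measurable C /\ A = C `&` B n] }.

Section measures.
Context d (X : measurableType d) (R : realType).
Implicit Types mu nu : {measure set X -> \bar R}.

Definition locally_finite (X0 : localising_ring X) mu : Prop :=
  forall B, X0 B -> mu B < +oo.

(* The library's measures are functions on all subsets of X and carry
   arbitrary values on the non-measurable ones.  Equality of measures is
   therefore equality on the measurable sets, not Leibniz equality. *)
Definition measeq mu nu : Prop := forall B, measurable B -> mu B = nu B.

Definition measle mu nu : Prop := forall B, measurable B -> mu B <= nu B.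

Definition supp mu : set X := [set x | 0 < mu [set x]].

(* nu_B, the restriction of nu to a measurable set B; total in B, with the
   value 0 when B is not measurable *)
Definition restr mu (B : set X) : {measure set X -> \bar R} :=
  match pselect (measurable B) with
  | left mB => mrestr mu mB
  | right _ => mzero
  end.

End measures.

Section measure_diff.
Context d (X : measurableType d) (R : realType).
Variables (mu nu : {finite_measure set X -> \bar R}) (numu : measle nu mu).

(* maxe makes it nonnegative on non-measurable sets too *)
Let diff (B : set X) : \bar R := maxe 0 (mu B - nu B).

Let diffE B : measurable B -> diff B = mu B - nu B.
Proof.
move=> mB; rewrite /diff max_r// sube_ge0 ?numu//.
by rewrite fin_num_measure.
Qed.

Let diff0 : diff set0 = 0.
Proof. by rewrite diffE// !measure0 sube0. Qed.

Let diff_ge0 B : 0 <= diff B.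
Proof. by rewrite /diff le_max lexx. Qed.

Let diff_sigma_additive : semi_sigma_additive diff.
Proof.
move=> F mF tF mUF; rewrite diffE//.
rewrite [X in X @ _ --> _](_ : _ = (fun n => \sum_(0 <= i < n) mu (F i))
    \- (fun n => \sum_(0 <= i < n) nu (F i))).
  apply: cvgeB; first by rewrite fin_num_adde_defr// fin_num_measure.
  - exact: measure_semi_sigma_additive.
  - exact: measure_semi_sigma_additive.
apply/funext => n /=; under eq_bigr do rewrite diffE//.
rewrite big_split/= fin_num_sumeN// => i _.
by rewrite fin_num_measure.
Qed.

HB.instance Definition _ :=
  isMeasure.Build _ _ _ diff diff0 diff_ge0 diff_sigma_additive.

Lemma ex_measure_diff : exists rho : {measure set X -> \bar R},
  forall B, measurable B -> rho B + nu B = mu B.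
Proof.
exists diff => B mB /=; rewrite diffE// subeK//.
by rewrite fin_num_measure.
Qed.

End measure_diff.

Section counting_measures.
Context d (X : measurableType d) (X0 : localising_ring X) (R : realType).

Definition nat_valued (mu : {measure set X -> \bar R}) : Prop :=
  forall B, X0 B -> exists n : nat, mu B = n%:R%:E.

Record Nmeas := NMeas {
  Nmeas_measure :> {measure set X -> \bar R};
  Nmeas_nat : nat_valued Nmeas_measure }.

Let nat_valued0 : nat_valued mzero.
Proof. by move=> B _; exists 0%N. Qed.

Let nat_valued_dirac x : nat_valued (dirac x).
Proof. by move=> B _; exists (x \in B); rewrite /= diracE. Qed.

Let nat_valuedD (mu nu : Nmeas) : nat_valued (measure_add mu nu).
Proof.
move=> B X0B; have [m muB] := Nmeas_nat mu X0B.
have [n nuB] := Nmeas_nat nu X0B.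
by exists (m + n)%N; rewrite [LHS](measure_addE mu nu) muB nuB -EFinD -natrD.
Qed.

Let nat_valued_restr (mu : Nmeas) B : nat_valued (restr mu B).
Proof.
rewrite /restr; case: pselect => [mB A X0A|_]; last exact: nat_valued0.
by rewrite /= /mrestr; apply: Nmeas_nat; exact: lring_setI.
Qed.

Definition zeroN : Nmeas := NMeas nat_valued0.
Definition diracN x : Nmeas := NMeas (@nat_valued_dirac x).
Definition addN (mu nu : Nmeas) : Nmeas := NMeas (@nat_valuedD mu nu).
Definition restrN (mu : Nmeas) B : Nmeas := NMeas (@nat_valued_restr mu B).

HB.instance Definition _ := gen_eqMixin Nmeas.
HB.instance Definition _ := gen_choiceMixin Nmeas.
HB.instance Definition _ := isPointed.Build Nmeas zeroN.

(* the smallest sigma-field making mu |-> mu B measurable for all measurable B *)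
Definition Nmeas_measurable : set (set Nmeas) :=
  <<s \bigcup_(B in measurable)
        preimage_set_system [set: Nmeas] (fun mu => mu B) measurable >>.

Let Nmeas_measurable0 : Nmeas_measurable set0.
Proof. exact: sigma_algebra0. Qed.

Let Nmeas_measurableC A : Nmeas_measurable A -> Nmeas_measurable (~` A).
Proof. exact: sigma_algebraC. Qed.

Let Nmeas_measurableU (F : (set Nmeas)^nat) :
  (forall i, Nmeas_measurable (F i)) -> Nmeas_measurable (\bigcup_i F i).
Proof. exact: sigma_algebra_bigcup. Qed.

Definition Nmeas_display : measure_display.
Proof. by constructor. Qed.

HB.instance Definition _ := @isMeasurable.Build Nmeas_display Nmeas
  Nmeas_measurable Nmeas_measurable0 Nmeas_measurableC Nmeas_measurableU.

(* mu - nu: the element rho of N with rho + nu = mu (zeroN if there is none).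
   By subNK it exists whenever nu <= mu; it is unique up to measeq because
   elements of N are sigma-finite. *)
Definition subN (mu nu : Nmeas) : Nmeas :=
  xget zeroN [set rho | measeq (addN rho nu) mu].

Lemma Nmeas_fin_num (mu : Nmeas) B : X0 B -> mu B \is a fin_num.
Proof. by move=> /(Nmeas_nat mu)[n ->]. Qed.

Lemma subNK (mu nu : Nmeas) :
  measle nu mu -> measeq (addN (subN mu nu) nu) mu.
Proof.
move=> numu; suff [rho rhoE] :
    exists rho : Nmeas, measeq (addN rho nu) mu.
  by rewrite /subN; case: xgetP => [_ _ //|/(_ rho)/(_ rhoE)].
have [B [X0B _ BT _]] := lring_exhaustion X0.
have [ring0 ringU ringD] := lring_setring X0.
pose E := seqDU B.
have X0E n : X0 (E n).
  apply: ringD => //; elim/big_ind : _ => // *; exact: ringU.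
have mE n : measurable (E n) by exact: lring_measurable (X0E n).
have ET : \bigcup_n E n = setT by rewrite -seqDU_bigcup_eq.
have fin (m : Nmeas) n : m (E n) < +oo.
  by rewrite ltey_eq Nmeas_fin_num.
have /choice[rho rhoE] n : exists rho : {measure set X -> \bar R},
    forall A, measurable A -> rho A + nu (A `&` E n) = mu (A `&` E n).
  apply: (@ex_measure_diff _ _ _ (mfrestr (mE n) (fin mu n))
            (mfrestr (mE n) (fin nu n))) => A mA.
  by apply: numu; exact: measurableI.
have split_sum (m : Nmeas) A : measurable A ->
    m A = \sum_(0 <= n <oo) m (A `&` E n).
  move=> mA; rewrite -[in LHS](setIT A) -ET setI_bigcupr measure_semi_bigcup//.
  - by move=> i; exact: measurableI.
  - exact/trivIset_setIl/trivIset_seqDU.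
  - by apply: bigcup_measurable => i _; exact: measurableI.
have sumE A : measurable A -> mseries rho 0 A + nu A = mu A.
  move=> mA; rewrite (split_sum nu)// (split_sum mu)// -nneseriesD//.
  by apply: eq_eseriesr => n _; exact: rhoE.
have rho_nat : nat_valued (mseries rho 0).
  move=> A X0A; have mA := lring_measurable X0A.
  have [m muA] := Nmeas_nat mu X0A; have [n nuA] := Nmeas_nat nu X0A.
  exists (m - n)%N; move: (numu A mA) (sumE A mA).
  rewrite muA nuA lee_fin ler_nat => nm.
  move=> /(congr1 (fun x => x - n%:R%:E)); rewrite addeK// => h.
  by apply: etrans h _; rewrite -EFinB natrB.
by exists (NMeas rho_nat) => A mA; rewrite [LHS]measure_addE; exact: sumE.
Qed.

End counting_measures.

(* A measurable D only depends on the values of its argument on measurable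
   sets, up to measeq: the sets {mu | D mu B \in U} belong to the sigma-field
   of N, and every member of that sigma-field is stable under measeq. *)
Record generator d (X : measurableType d) (X0 : localising_ring X)
    (R : realType) (D : Nmeas X0 R -> Nmeas X0 R) : Prop := {
  generator_measurable : measurable_fun setT D;
  generator_thinning : forall mu, measle (D mu) mu;
  generator_additivity : forall mu x, supp (D mu) x ->
    measeq (D (addN mu (diracN X0 R x))) (addN (D mu) (diracN X0 R x));
  generator_idempotency : forall mu mu' : Nmeas X0 R,
    measle mu' (subN mu (D mu)) -> measeq (D (addN (D mu) mu')) (D mu);
  generator_consistency : forall mu mu' : Nmeas X0 R,
    measle mu' mu -> measeq (D mu) (D mu') ->
    forall psi, measeq (D (addN mu psi)) (D (addN mu' psi)) }.

Section hull.
Context d (X : measurableType d) (X0 : localising_ring X) (R : realType).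
Variable D : Nmeas X0 R -> Nmeas X0 R.

Definition Hind (x : X) (mu : Nmeas X0 R) : R :=
  (`[< ~ measeq (D (addN mu (diracN X0 R x))) (D mu) >])%:R.

Definition hull (mu : Nmeas X0 R) : set X := [set x | Hind x mu = 0%R].

End hull.

Section conditional_expectation.
Context d (Om : measurableType d) (R : realType) (P : probability Om R).
Context d' (S : measurableType d') (Z : Om -> S).

(* Yh is a version of E[Y | sigma(Z)] *)
Definition is_cond_exp (Y Yh : Om -> \bar R) : Prop :=
  [/\ P.-integrable setT Yh,
      measurable_fun [set: g_sigma_algebra_preimageType Z] Yh
    & forall A, g_sigma_algebra_preimage Z A ->
        \int[P]_(w in A) Yh w = \int[P]_(w in A) Y w].

Definition cond_exp (Y : Om -> \bar R) : Om -> \bar R :=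
  xget (cst 0) [set Yh | is_cond_exp Y Yh].

Definition cond_prob (A : set Om) : Om -> \bar R :=
  cond_exp (fun w => (\1_A w)%:E).

End conditional_expectation.

Section poisson_process.
Context d (Om : measurableType d) (R : realType) (P : probability Om R).

(* Y has the Poisson distribution with mean r in [0, +oo]; Po(+oo) is the unit
   mass at +oo and Po(0) the unit mass at 0.  The second argument of
   poisson_prob is a dummy.  poisson_pmf is not used because poisson_pmf 0 k is
   1 for all k. *)
Definition poisson_distributed (Y : Om -> \bar R) (r : \bar R) : Prop :=
  match r with
  | s%:E => (0 <= s)%R /\
      forall n, P [set w | Y w = n%:R%:E] = poisson_prob s 0%N [set n]
  | +oo => P [set w | Y w = +oo] = 1
  | -oo => False
  end.

(* taking some of the A i equal to setT gives the product rule for all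
   subfamilies *)
Definition independent (I : finType) (Y : I -> Om -> \bar R) : Prop :=
  forall A : I -> set (\bar R), (forall i, measurable (A i)) ->
    P (\bigcap_i (Y i @^-1` A i)) = \prod_i P (Y i @^-1` A i).

Record poisson_process d' (X : measurableType d') (X0 : localising_ring X)
    (lambda : {measure set X -> \bar R}) (eta : Om -> Nmeas X0 R) : Prop := {
  poisson_process_measurable : measurable_fun setT eta;
  poisson_process_distr : forall B, measurable B ->
    exists r, poisson_distributed (fun w => eta w B) r;
  poisson_process_mean : forall B, measurable B ->
    \int[P]_w eta w B = lambda B;
  poisson_process_indep : forall n (B : 'I_n -> set X),
    (forall i, measurable (B i)) -> trivIset setT B ->
    independent (fun i w => eta w (B i)) }.

End poisson_process.

(* Pi_lambda, the distribution of a Poisson process with intensity measure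
   lambda, i.e. the probability measure on N under which the identity is such a
   process; it exists and is unique for locally finite lambda. *)
Definition poisson_law d (X : measurableType d) (X0 : localising_ring X)
    (R : realType) (lambda : {measure set X -> \bar R}) :
    probability (Nmeas X0 R) R :=
  xget (dirac (zeroN X0 R) : probability (Nmeas X0 R) R)
    [set Q : probability (Nmeas X0 R) R | poisson_process Q lambda id].

Definition strong_markov d (Om : measurableType d) (R : realType)
    (P : probability Om R) d' (X : measurableType d')
    (X0 : localising_ring X) (D : Nmeas X0 R -> Nmeas X0 R)
    (lambda : {measure set X -> \bar R}) (eta : Om -> Nmeas X0 R) : Prop :=
  forall A : set (Nmeas X0 R), measurable A ->
    {ae P, forall w,
      cond_prob P (D \o eta) [set w' | A (restrN (eta w') (hull D (eta w')))] w
      = poisson_law X0 (restr lambda (hull D (eta w))) A}.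

(* Main.v *)
(* Write nu for D mu. The axioms force nu and mu to agree on supp nu, H_z(mu) to
   depend on mu only through nu, and H_z(mu - delta_z) to be the indicator of
   supp nu on supp mu. So the right-hand side plus F, i.e.
   int f d(D eta) + int f(z) (1 - H_z(D eta)) lambda(dz), is a function of D eta.
   It has the same integral as F^* over each event {D eta in A}, by the Mecke
   equation
     E int g(z, eta) eta(dz) = E int g(z, eta + delta_z) lambda(dz)
   for g(z, mu) = 1_A(D mu) f(z) 1{z notin supp (D mu)}: for such z, removing z
   from mu does not change D mu.
   The Mecke equation reduces to events that prescribe the counts of eta on a
   finite partition, where it follows from independence and
   (n + 1) Po_r(n + 1) = r Po_r(n). *)

From HB Require Import structures.
Require Import Defs.
From mathcomp Require Import all_boot all_order all_algebra.
From mathcomp Require Import all_classical all_reals all_analysis.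
From mathcomp Require Import measurable_realfun ring.

Set Implicit Arguments.
Unset Strict Implicit.
Unset Printing Implicit Defensive.

Import Order.TTheory GRing.Theory Num.Theory.
Import numFieldNormedType.Exports.

Local Open Scope classical_set_scope.
Local Open Scope ring_scope.
Local Open Scope ereal_scope.

(** * Integer-valued measures *)

(** The pi-system for the Mecke equation has to generate the sigma-field of X x N although each of
    its members looks at finitely many counts only. It is cut out by the finite fields of a
    countable generating family of sets, and it generates because integer-valued measures leave only
    countably many vectors of counts on each of these fields. Total masses may be infinite, so the
    two sides are compared separately on the points of one ring set, where each has mass [lambda] of
    that set. On the generator side, statements about supports become statements about masses only
    because integer-valued measures on a Borel space sit on their atoms. The Mecke equation is an
    identity for nonnegative integrands, hence the final split of f into positive and negative
    parts. *)

Section localised_measures.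
Context {d} {X : measurableType d} (X0 : localising_ring X) (R : realType).
Implicit Types (mu nu rho : Nmeas X0 R) (A B : set X).

Lemma lring_partition : exists E : (set X)^nat,
  [/\ forall n, X0 (E n), trivIset setT E & \bigcup_n E n = setT].
Proof.
have [B [X0B _ BT _]] := lring_exhaustion X0.
have [ring0 ringU ringD] := lring_setring X0.
exists (seqDU B); split; last by rewrite -seqDU_bigcup_eq.
- by move=> n; apply: ringD => //; elim/big_ind : _ => // *; exact: ringU.
- exact: trivIset_seqDU.
Qed.

Lemma measure_partition (m : {measure set X -> \bar R}) (E : (set X)^nat) A :
  (forall n, measurable (E n)) -> trivIset setT E -> \bigcup_n E n = setT ->
  measurable A -> m A = \sum_(0 <= n <oo) m (A `&` E n).
Proof.
move=> mE tE ET mA.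
rewrite -[in LHS](setIT A) -ET setI_bigcupr measure_semi_bigcup//.
- by move=> i; exact: measurableI.
- exact/trivIset_setIl.
- by apply: bigcup_measurable => i _; exact: measurableI.
Qed.

Lemma le_measure_lring (m1 m2 : {measure set X -> \bar R}) :
  (forall B, X0 B -> m1 B <= m2 B) -> measle m1 m2.
Proof.
move=> m12 A mA; have [E [X0E tE ET]] := lring_partition.
have mE n := lring_measurable (X0E n).
rewrite (measure_partition m1 mE tE ET mA) (measure_partition m2 mE tE ET mA).
apply: lee_nneseries => // n _; apply: m12.
by rewrite setIC; exact: lring_setI.
Qed.

(** Cancelling [rho] is sound on ring sets, where its mass is finite; countable additivity carries
    the inequality to all measurable sets. *)
Lemma measleD2r mu nu rho :
  measle (addN mu rho) (addN nu rho) -> measle mu nu.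
Proof.
move=> h; apply: le_measure_lring => B X0B.
have := h B (lring_measurable X0B).
rewrite [addN _ _ B]measure_addE [addN nu _ B]measure_addE leeD2rE//.
exact: Nmeas_fin_num.
Qed.

Lemma measeq_sym mu nu : measeq mu nu -> measeq nu mu.
Proof. by move=> h B mB; rewrite h. Qed.

Lemma measeq_trans {nu mu rho} :
  measeq mu nu -> measeq nu rho -> measeq mu rho.
Proof. by move=> h h' B mB; rewrite h// h'. Qed.

Lemma addNE mu nu B : addN mu nu B = mu B + nu B.
Proof. exact: measure_addE. Qed.

(** Natural values are given on ring sets only. If [mu A] is finite, the masses of A within the
    exhausting sets are naturals bounded by the truncation of [mu A]; their maximum is attained and,
    by continuity from below, equals [mu A]. *)
Lemma Nmeas_natP mu A : measurable A ->
  mu A = +oo \/ exists n : nat, mu A = n%:R%:E.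
Proof.
move=> mA; have [->|muA] := eqVneq (mu A) +oo; [by left|right].
have muAfin : mu A \is a fin_num by rewrite ge0_fin_numE// ltey.
have [B [X0B Bnd BT _]] := lring_exhaustion X0.
have X0AB k : X0 (A `&` B k) by rewrite setIC; exact: lring_setI.
have mAB k := lring_measurable (X0AB k).
have leAB k : mu (A `&` B k) <= mu A.
  by apply: le_measure; rewrite ?inE//; exact: subIsetl.
pose P n := `[< exists k, mu (A `&` B k) = n%:R%:E >].
have exP : exists n, P n.
  by have [n nE] := Nmeas_nat mu (X0AB 0%N); exists n; apply/asboolP; exists 0%N.
have ubP n : P n -> (n <= Num.truncn (fine (mu A)))%N.
  move=> /asboolP[k kn]; rewrite truncn_ge_nat ?fine_ge0// -lee_fin fineK//.
  by rewrite -kn.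
case: (ex_maxnP exP ubP) => M /asboolP[K KM] maxM.
exists M; apply/eqP; rewrite eq_le -{2}KM leAB andbT.
have ndAB : {homo (fun k => A `&` B k) : n m / (n <= m)%N >-> (n <= m)%O}.
  move=> n m nm; rewrite subsetEset; apply: setIS.
  by move/subsetPset : (nm) => ?; exact: (homo_leq (@subset_refl _)
    (fun _ _ _ => @subset_trans _ _ _ _) Bnd).
have cvgA : (mu \o (fun k => A `&` B k)) x @[x --> \oo] --> mu A.
  rewrite -[X in mu X](setIT A) -BT setI_bigcupr.
  by apply: nondecreasing_cvg_mu => //; exact: bigcup_measurable.
rewrite -(cvg_lim _ cvgA)//; apply: lime_le; first by apply/cvg_ex; exists (mu A).
apply: nearW => k /=; have [n nE] := Nmeas_nat mu (X0AB k).
by rewrite nE lee_fin ler_nat maxM//; apply/asboolP; exists k.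
Qed.

Lemma Nmeas_measureD mu A B : measurable A -> measurable B -> mu A < +oo ->
  mu (A `\` B) = mu A - mu (A `&` B).
Proof. by move=> mA mB muA; exact: measureD. Qed.

Lemma Nmeas_measureDI mu A B : measurable A -> measurable B ->
  mu A = mu (A `\` B) + mu (A `&` B).
Proof. exact: measureDI. Qed.

Lemma Nmeas_gt0 mu A : measurable A -> (0 < mu A) = (1 <= mu A).
Proof.
move=> mA; have [->|[n ->]] := Nmeas_natP mu mA; first by rewrite lt0y leey.
by rewrite lte_fin ltr0n lee_fin ler1n.
Qed.

Lemma measurable_fun_eval B : measurable B ->
  measurable_fun setT (fun mu => mu B).
Proof.
move=> mB _ Y mY; rewrite setTI; apply: sub_sigma_algebra.
by exists B => //; exists Y => //; rewrite setTI.
Qed.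

Lemma measurable_fun_NmeasP {d'} {T : measurableType d'} (h : T -> Nmeas X0 R) :
  (forall B, measurable B -> measurable_fun setT (fun t => h t B)) ->
  measurable_fun setT h.
Proof.
move=> mh; apply: (@measurability _ _ _ _ _ _ (\bigcup_(B in measurable)
  preimage_set_system [set: Nmeas X0 R] (fun mu => mu B) measurable)) => //.
move=> _ [_ [B mB [Y mY <-]] <-]; rewrite !setTI.
by have := mh B mB measurableT Y mY; rewrite setTI.
Qed.

Lemma measurable_fun_addN {d'} {T : measurableType d'}
    (h1 h2 : T -> Nmeas X0 R) :
  measurable_fun setT h1 -> measurable_fun setT h2 ->
  measurable_fun setT (fun t => addN (h1 t) (h2 t)).
Proof.
move=> m1 m2; apply: measurable_fun_NmeasP => B mB.
under eq_fun do rewrite addNE.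
by apply: emeasurable_funD; exact: (measurableT_comp (measurable_fun_eval mB)).
Qed.

Lemma measurable_fun_diracN : measurable_fun setT (diracN X0 R).
Proof.
apply: measurable_fun_NmeasP => B mB.
exact/measurable_EFinP/measurable_indic.
Qed.

(** The sets stable under [measeq] form a sigma-field that contains the preimages under evaluation
    maps. *)
Lemma measeq_measurable (A : set (Nmeas X0 R)) mu nu :
  measurable A -> measeq mu nu -> A mu -> A nu.
Proof.
move=> mA; pose S := [set V : set (Nmeas X0 R) |
  forall m n : Nmeas X0 R, measeq m n -> V m -> V n].
suff : S A by apply.
move: A mA; apply: smallest_sub; first split.
- by move=> m n.
- by move=> V SV m n mn [_ nVm]; split => // /(SV n m (measeq_sym mn)).
- by move=> F SF m n mn [k _ Fk]; exists k => //; exact: SF Fk.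
by move=> _ [B mB [Y mY <-]] m n mn [_ /= Ym]; split => //=; rewrite -mn.
Qed.

End localised_measures.

(** * Kernels of locally finite measures *)

Section sfinite_of_partition.
Context {d d'} {T : measurableType d} {X : measurableType d'} {R : realType}.
Variables (k : T -> {measure set X -> \bar R}) (E : (set X)^nat).
Hypotheses (mk : forall U, measurable U -> measurable_fun setT (k ^~ U))
  (mE : forall n, measurable (E n)) (tE : trivIset setT E)
  (ET : \bigcup_n E n = setT) (kE : forall t n, k t (E n) < +oo).

(** The mass of [E j] is finite for each t but need not be bounded in t. Splitting by its integer
    part makes every piece a uniformly bounded kernel. *)
Let level n t j := (n%:R%:E <= k t (E j)) && (k t (E j) < n.+1%:R%:E).

Let piece j n t : {measure set X -> \bar R} :=
  if level n t j then [the measure _ _ of mrestr (k t) (mE j)]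
  else [the measure _ _ of mzero].

Let measurable_piece j n U : measurable U ->
  measurable_fun setT ((piece j n) ^~ U).
Proof.
move=> mU; rewrite (_ : (fun t => _) = fun t =>
    if level n t j then k t (U `&` E j) else 0); last first.
  by apply/funext => t; rewrite /piece; case: ifPn.
have mkE := mk (mE j).
apply: measurable_fun_if => //.
- by apply: measurable_and; [exact: measurable_fun_lee|exact: measurable_fun_lte].
- by apply: measurable_funTS; apply: mk; exact: measurableI.
Qed.

HB.instance Definition _ j n := isKernel.Build _ _ _ _ R (piece j n)
  (@measurable_piece j n).

Let piece_uub j n : measure_fam_uub (piece j n).
Proof.
exists n.+1%:R => t; rewrite /piece; case: ifPn => [/andP[_]|_].
  by rewrite /= /mrestr setTI.
by rewrite lte_fin.
Qed.

HB.instance Definition _ j n :=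
  Kernel_isFinite.Build _ _ _ _ R (piece j n) (@piece_uub j n).

Lemma sfinite_kernel_of_partition :
  exists s : R.-sfker T ~> X, forall t U, measurable U -> s t U = k t U.
Proof.
pose kj j : R.-sfker T ~> X := kseries (fun n => piece j n : R.-sfker T ~> X).
exists (kseries kj) => t U mU; apply/esym.
rewrite /= /kseries /mseries/= (measure_partition (k t) mE tE ET mU).
apply: eq_eseriesr => j _.
have fkE : k t (E j) \is a fin_num by rewrite ge0_fin_numE.
(* For fixed t a single level is occupied, so the inner series has one nonzero term. *)
pose N := Num.truncn (fine (k t (E j))).
have levelE n : level n t j = (n == N).
  rewrite /level -(fineK fkE) lee_fin lte_fin /N.
  rewrite -truncn_ge_nat ?fine_ge0// -truncn_lt_nat ?fine_ge0// ltnS.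
  by rewrite eqn_leq.
rewrite /mseries (@nneseriesD1 _ _ N)//= eseries0.
  by rewrite adde0 /piece levelE eqxx.
by move=> n _ /= /negbTE nN; rewrite /piece levelE nN.
Qed.
End sfinite_of_partition.

Section campbell.
Context {d d' d''} {X : measurableType d} {Om : measurableType d'}
  {Z : measurableType d''} {R : realType}.

(** [C] is the image under [phi] of the measure P(dw) kappa_w(dx), built by composing the constant
    kernel [P], the kernel [k] and the Dirac kernel at [phi]. The factor [unit] is the source that
    kernel composition asks for. This turns either side of the Mecke equation into integration
    against one measure. *)
Lemma campbell_measure (P : probability Om R)
    (kappa : Om -> {measure set X -> \bar R}) (k : R.-sfker (unit * Om) ~> X)
    (phi : Om * X -> Z) :
  (forall w U, measurable U -> k (tt, w) U = kappa w U) ->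
  measurable_fun setT phi ->
  exists C : {measure set Z -> \bar R}, forall g : Z -> \bar R,
    (forall z, 0 <= g z) -> measurable_fun setT g ->
    \int[C]_z g z = \int[P]_w \int[kappa w]_x g (phi (w, x)).
Proof.
move=> kE mphi.
have mP : measurable_fun setT (fun _ : unit => P : pprobability Om R) by [].
have mpsi : measurable_fun setT (fun p : (unit * Om) * X => phi (p.1.2, p.2)).
  apply: (measurableT_comp mphi); apply: measurable_fun_pair => //.
  exact: (measurableT_comp measurable_snd measurable_fst).
pose l : R.-sfker unit ~> Om := kprobability mP.
pose kd : R.-sfker ((unit * Om) * X) ~> Z := kdirac mpsi.
pose kk : R.-sfker (unit * Om) ~> Z := k \; kd.
exists ((l \; kk) tt) => g g0 mg.
rewrite [LHS](@integral_kcomp _ _ _ _ _ _ _ l kk tt)//.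
apply: eq_integral => w _.
rewrite [LHS](@integral_kcomp _ _ _ _ _ _ _ k kd (tt, w))//.
rewrite [LHS](@eq_measure_integral _ _ _ _ (kappa w)); last first.
  by move=> U mU _; exact: kE.
apply: eq_integral => x _.
by rewrite /= /kdirac integral_dirac// diracT mul1e.
Qed.

End campbell.

Section localised_kernels.
Context {d d'} {T : measurableType d} {X : measurableType d'}
  (X0 : localising_ring X) {R : realType}.

Lemma Nmeas_sfkernel (h : T -> Nmeas X0 R) : measurable_fun setT h ->
  exists k : R.-sfker T ~> X, forall t U, measurable U -> k t U = h t U.
Proof.
move=> mh; have [E [X0E tE ET]] := lring_partition X0.
have mE n := lring_measurable (X0E n).
apply: (@sfinite_kernel_of_partition _ _ _ _ _ h E) => //.
- by move=> U mU; exact: (measurableT_comp (measurable_fun_eval mU) mh).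
- by move=> t n; rewrite ltey_eq Nmeas_fin_num.
Qed.

Lemma locally_finite_sfkernel (lambda : {measure set X -> \bar R}) :
  locally_finite X0 lambda ->
  exists k : R.-sfker T ~> X, forall t U, measurable U -> k t U = lambda U.
Proof.
move=> flambda; have [E [X0E tE ET]] := lring_partition X0.
have mE n := lring_measurable (X0E n).
apply: (@sfinite_kernel_of_partition _ _ _ _ _ (fun=> lambda) E) => // t n.
exact: flambda.
Qed.

Lemma measurable_fun_integral_Nmeas (h : T -> Nmeas X0 R)
    (g : T * X -> \bar R) :
  measurable_fun setT h -> (forall p, 0 <= g p) -> measurable_fun setT g ->
  measurable_fun setT (fun t => \int[h t]_x g (t, x)).
Proof.
move=> mh g0 mg; have [k kE] := Nmeas_sfkernel mh.
rewrite (_ : (fun t => _) = fun t => \int[k t]_x g (t, x)).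
  exact: measurable_fun_integral_sfinite_kernel.
by apply/funext => t; apply: eq_measure_integral => A mA _; rewrite kE.
Qed.

Lemma measurable_fun_integral_locally_finite
    (lambda : {measure set X -> \bar R}) (g : T * X -> \bar R) :
  locally_finite X0 lambda -> (forall p, 0 <= g p) -> measurable_fun setT g ->
  measurable_fun setT (fun t => \int[lambda]_x g (t, x)).
Proof.
move=> flambda g0 mg; have [k kE] := locally_finite_sfkernel flambda.
rewrite (_ : (fun t => _) = fun t => \int[k t]_x g (t, x)).
  exact: measurable_fun_integral_sfinite_kernel.
by apply/funext => t; apply: eq_measure_integral => A mA _; rewrite kE.
Qed.

End localised_kernels.

(** * Borel spaces: singletons, the diagonal and a countable separating generator *)

Section borel_space.
Context {d} {X : measurableType d} {R : realType} (hX : borel_space R X).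

Lemma borel_space_set1 (x : X) : measurable [set x].
Proof.
have [phi [mphi iphi _ _]] := hX.
rewrite (_ : [set x] = setT `&` phi @^-1` [set phi x]); first exact: mphi.
by apply/seteqP; split => [y ->|y [_ /iphi]].
Qed.

Lemma borel_space_diag : measurable [set p : X * X | p.1 = p.2].
Proof.
have [phi [mphi iphi _ _]] := hX.
rewrite (_ : [set _ | _] = [set p | phi p.1 == phi p.2]).
  rewrite -[X in measurable X]setTI; apply: measurable_fun_eqr => //.
  - exact: measurableT_comp.
  - exact: measurableT_comp.
by apply/seteqP; split => [[x y] /= ->//|[x y] /= /eqP/iphi].
Qed.

(** Pull back the rational half-lines along the embedding. They generate because images of
    measurable sets are measurable, so each A is the preimage of its own image; they separate points
    by injectivity and density of the rationals. *)
Lemma borel_space_generators : exists h : rat -> set X,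
  [/\ forall q, measurable (h q), measurable `<=` <<s range h >>
    & forall x y, (forall q, h q x <-> h q y) -> x = y].
Proof.
have [phi [mphi iphi _ mphiX]] := hX.
pose h (q : rat) : set X := phi @^-1` `]-oo, ratr q[; exists h; split.
- by move=> q; rewrite -[X in measurable X]setTI; exact: mphi.
- pose G := range h; move=> A mA.
  have mphiG : measurable_fun [set: g_sigma_algebraType G]
      (phi : g_sigma_algebraType G -> R).
    apply: (measurability _ (RGenInftyO.measurableE R)).
    move=> _ [_ [r ->] <-]; rewrite setTI.
    rewrite (_ : _ @^-1` _ = \bigcup_(q in [set q : rat | ratr q <= r]%R)
        phi @^-1` `]-oo, ratr q[).
      rewrite bigcup_mkcond; apply: bigcupT_measurable_rat => q.
      by case: ifPn => // _; apply: sub_sigma_algebra; exists q.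
    apply/seteqP; split => [x /= |x [q /= qr]]; rewrite !in_itv/=.
      move=> /rat_in_itvoo[q]; rewrite in_itv/= => /andP[xq qr].
      by exists q => /=; [exact: ltW|rewrite in_itv].
    by move=> /lt_le_trans; exact.
  suff -> : A = setT `&` phi @^-1` (phi @` A) by apply: mphiG => //; exact: mphiX.
  by apply/seteqP; split => [x Ax|x [_ [y Ay /iphi <-//]]]; split => //; exists x.
- move=> x y hxy; apply: iphi; apply/eqP; rewrite eq_le !leNgt.
  by apply/andP; split; apply/negP => /rat_in_itvoo[q];
    rewrite in_itv/= => /andP[lq ql]; have := hxy q; rewrite /h /= !in_itv/= lq;
    rewrite ltNge (ltW ql) => -[h1 h2]; [have := h2 isT|have := h1 isT].
Qed.

End borel_space.

(** * Nested partitions and the sigma-field of N *)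

Section binary_code.
Context {X : Type} (g : (set X)^nat).

(** The n bits record membership in the first n sets, so the fibres are the atoms of the finite
    field these generate. The newest bit is the lowest one, so that [half] recovers the coarser
    code. *)
Fixpoint bincode n (x : X) : nat :=
  if n is m.+1 then ((bincode m x).*2 + `[< g m x >])%N else 0%N.

Lemma bincode_lt n x : (bincode n x < 2 ^ n)%N.
Proof.
elim: n => //= n IH; rewrite expnS mul2n.
rewrite -[X in (X <= _)%N]addnS; case: asboolP => _.
  by rewrite addn2 -doubleS leq_double.
by rewrite addn1 ltn_double.
Qed.

Lemma code_coarse n m x y :
  (n <= m)%N -> bincode m x = bincode m y -> bincode n x = bincode n y.
Proof.
elim: m => [|m IH]; first by rewrite leqn0 => /eqP->.
rewrite leq_eqVlt => /predU1P[->//|nm] /= xy; apply: IH => //.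
move/(congr1 half): xy; rewrite ![(_.*2 + _)%N]addnC.
by rewrite !half_bit_double.
Qed.

Lemma code_gen n i x y : (i < n)%N -> bincode n x = bincode n y -> g i x -> g i y.
Proof.
move=> /code_coarse h /h /= /(congr1 odd); rewrite !oddD !odd_double !oddb/=.
by move=> xy /asboolP gx; apply/asboolP; rewrite -xy.
Qed.

(** These are the unions of fibres of [bincode], that is, the members of the finite field generated
    by the first n sets. *)
Definition saturated n (A : set X) :=
  forall x y, bincode n x = bincode n y -> A x -> A y.

Lemma saturated_preimage n A : saturated n A -> A = bincode n @^-1` (bincode n @` A).
Proof.
by move=> sA; apply/seteqP; split => [x Ax|x [y Ay /sA]]; [exists x|exact].
Qed.

Lemma preimage_saturated n S : saturated n (bincode n @^-1` S).
Proof. by move=> x y /= ->. Qed.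

Lemma saturatedS n m A : (n <= m)%N -> saturated n A -> saturated m A.
Proof. by move=> nm sA x y /(code_coarse nm)/sA. Qed.

Lemma saturated_gen n i : (i < n)%N -> saturated n (g i).
Proof. by move=> lin x y; exact: code_gen. Qed.

Lemma saturatedI n A B : saturated n A -> saturated n B -> saturated n (A `&` B).
Proof. by move=> sA sB x y xy [/(sA _ _ xy) ? /(sB _ _ xy) ?]. Qed.

End binary_code.

Section measurable_code.
Context {d} {X : measurableType d} {R : realType} (g : (set X)^nat)
  (mg : forall n, measurable (g n)).

Lemma measurable_code n S : measurable (bincode g n @^-1` S).
Proof.
elim: n S => [|n IH] S /=.
  rewrite (_ : _ @^-1` _ = [set x | S 0%N])//.
  have [S0|S0] := pselect (S 0%N).
    by rewrite (_ : mkset _ = setT)//; apply/seteqP; split.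
  by rewrite (_ : mkset _ = set0)//; apply/seteqP; split.
rewrite (_ : _ @^-1` _ = (bincode g n @^-1` [set k | S (k.*2 + 1)%N] `&` g n) `|`
   (bincode g n @^-1` [set k | S (k.*2 + 0)%N] `&` ~` g n)).
  by apply: measurableU; apply: measurableI => //; exact: measurableC.
apply/seteqP; split => x /=.
  by case: asboolP => gx; [left|right].
by move=> [[h gx]|[h gx]]; case: asboolP.
Qed.

Lemma measurable_saturated n A : saturated g n A -> measurable A.
Proof. by move=> /saturated_preimage ->; exact: measurable_code. Qed.

Lemma measure_code (mu : {measure set X -> \bar R}) n S :
  mu (bincode g n @^-1` S) =
  \sum_(i < 2 ^ n | `[< S i >]) mu (bincode g n @^-1` [set val i]).
Proof.
rewrite -measure_bigsetU_ord_cond//; last 2 first.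
  by move=> i _; exact: measurable_code.
  by move=> i j _ _ [x [/= -> /val_inj]].
congr (mu _); apply/seteqP; split => [x Sx|x].
  rewrite -bigcup_seq_cond/=.
  exists (Ordinal (bincode_lt g n x)) => //=.
  by rewrite mem_index_enum; apply/asboolP.
by rewrite -bigcup_seq_cond => -[i /andP[_ /asboolP Si] /= ->].
Qed.

End measurable_code.

Section cells.
Context {d} {X : measurableType d} (X0 : localising_ring X) {R : realType}.
Variable g : (set X)^nat.
Hypotheses (mg : forall n, measurable (g n))
  (g_gen : measurable `<=` <<s range g >>)
  (g_lring : exists B : (set X)^nat, [/\ forall n, X0 (B n),
     forall n, B n `<=` B n.+1, \bigcup_n B n = setT
   & forall n, exists i, g i = B n]).
Local Notation N := (Nmeas X0 R).
Implicit Types (p q : X * N) (V : set (X * N)).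

(** Asking for equal masses on all saturated sets, not on atoms alone, makes passage to a coarser
    level immediate; by finite additivity both requirements agree. *)
Definition same_cell n p q := bincode g n p.1 = bincode g n q.1 /\
  forall A, saturated g n A -> p.2 A = q.2 A.

Definition cell n q : set (X * N) := [set p | same_cell n p q].

(* Every point of a cell is its centre, and cells shrink with the level, so two
   cells are either disjoint or nested. *)
Definition cells : set (set (X * N)) :=
  [set V | V = set0 \/ V = setT \/ exists n q, V = cell n.+1 q].

Lemma same_cell_sym n p q : same_cell n p q -> same_cell n q p.
Proof. by move=> [pq h]; split => // A sA; rewrite h. Qed.

Lemma same_cell_trans n r p q :
  same_cell n p r -> same_cell n r q -> same_cell n p q.
Proof.
move=> [pr h] [rq k]; split; first by rewrite pr.
by move=> A sA; rewrite h// k.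
Qed.

Lemma same_cell_coarse n m p q : (n <= m)%N ->
  same_cell m p q -> same_cell n p q.
Proof.
move=> nm [pq h]; split; first exact: code_coarse pq.
by move=> A sA; apply: h; exact: saturatedS sA.
Qed.

Lemma measurable_cell n q : measurable (cell n q).
Proof.
rewrite (_ : cell n q = fst @^-1` (bincode g n @^-1` [set bincode g n q.1]) `&`
    \bigcap_(i in [set: 'I_(2 ^ n)])
      (fun p => p.2 (bincode g n @^-1` [set val i])) @^-1`
        [set q.2 (bincode g n @^-1` [set val i])]).
  apply: measurableI.
    rewrite -[X in measurable X]setTI.
    by apply: measurable_fst => //; exact: measurable_code.
  apply: fin_bigcap_measurable => // i _; rewrite -[X in measurable X]setTI.
  have meval := measurable_fun_eval (X0 := X0) (R := R)
    (measurable_code mg n [set val i]).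
  exact: (measurableT_comp meval measurable_snd measurableT (emeasurable_set1 _)).
apply/seteqP; split => p [pq h]; split => //.
  by move=> i _; apply: h; exact: preimage_saturated.
move=> A sA; rewrite (saturated_preimage sA) (measure_code mg).
by rewrite [RHS](measure_code mg); apply: eq_bigr => i _; exact: h.
Qed.

Lemma setI_closed_cells : setI_closed cells.
Proof.
suff cI n q m r : (n <= m)%N -> cells (cell n.+1 q `&` cell m.+1 r).
  move=> V W [->|[->|[n [q ->]]]]; first by rewrite set0I; left.
    by rewrite setTI.
  move=> [->|[->|[m [r ->]]]]; first by rewrite setI0; left.
    by rewrite setIT; right; right; exists n, q.
  by have [nm|/ltnW mn] := leqP n m; [exact: cI|rewrite setIC; exact: cI].
move=> nm; have [[p [pq pr]]|h] := pselect (exists p,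
    same_cell n.+1 p q /\ same_cell m.+1 p r); last first.
  by left; apply/seteqP; split => // p [pq pr]; apply: h; exists p.
right; right; exists m, p; apply/seteqP; split => [s [sq sr]|s sp]; rewrite /cell/=.
  exact: same_cell_trans sr (same_cell_sym pr).
split; rewrite /cell/=; last exact: same_cell_trans sp pr.
exact: same_cell_trans (@same_cell_coarse n.+1 _ _ _ _ sp) pq.
Qed.

(** [None] stands for infinite mass; truncation loses nothing because finite masses are naturals. *)
Let value (y : \bar R) : option nat :=
  if y is r%:E then Some (Num.truncn r) else None.

Let value_inj (mu nu : N) A : measurable A ->
  value (mu A) = value (nu A) -> mu A = nu A.
Proof.
move=> mA; have [->|[m ->]] := Nmeas_natP mu mA;
  have [->|[n ->]] := Nmeas_natP nu mA => //=.
by rewrite !natrK => -[->].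
Qed.

Let label n p : nat := pickle (bincode g n p.1,
  [ffun i : 'I_(2 ^ n) => value (p.2 (bincode g n @^-1` [set val i]))]).

Let label_same_cell n p q : label n p = label n q -> same_cell n p q.
Proof.
move=> /(pcan_inj pickleK)[pq /ffunP h]; split => // A sA.
rewrite (saturated_preimage sA) (measure_code mg) [RHS](measure_code mg).
apply: eq_bigr => i _; apply: value_inj; first exact: measurable_code.
by have := h i; rewrite !ffunE.
Qed.

(* Nmeas_natP leaves only countably many cells at each level. *)
Lemma cells_saturated n V :
  (forall p q, same_cell n.+1 p q -> V q -> V p) -> <<s cells >> V.
Proof.
move=> sV; pose F k := \bigcup_(q in [set q | V q /\ label n.+1 q = k]) cell n.+1 q.
rewrite (_ : V = \bigcup_k F k).
  apply: sigma_algebra_bigcup => k.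
  have [[q [Vq qk]]|h] := pselect (exists q, V q /\ label n.+1 q = k).
    apply: sub_sigma_algebra; right; right; exists n, q.
    apply/seteqP; split => [p [r [Vr rk] pr]|p pq]; last by exists q.
    by apply: same_cell_trans pr _; apply: label_same_cell; rewrite rk.
  rewrite (_ : F k = set0); first exact: sigma_algebra0.
  by apply/seteqP; split => // p [q hq _]; apply: h; exists q.
apply/seteqP; split => [p Vp|p [k _ [q [Vq _] pq]]]; last exact: sV pq Vq.
by exists (label n.+1 p) => //; exists p.
Qed.

(** It suffices that both projections are measurable for the sigma-field of the cells. A set that is
    a union of cells of one level belongs to it, which settles the generators of X and the masses of
    saturated sets. *)
Lemma measurable_cells V : measurable V -> <<s cells >> V.
Proof.
pose T := g_sigma_algebraType cells.
have mfst : measurable_fun [set: T] (fst : T -> X).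
  move=> _ A mA; rewrite setTI.
  have : <<s range g >> A by exact: g_gen.
  move: A {mA}; apply: smallest_sub; first split => //=.
  - by rewrite preimage_set0; exact: sigma_algebra0.
  - move=> A mA; rewrite setTD preimage_setC; exact: (@measurableC _ T).
  - move=> F mF; rewrite preimage_bigcup; exact: (@bigcupT_measurable _ T).
  move=> _ [i _ <-]; apply: (@cells_saturated i) => -[x mu] [y nu] [/= xy _] /=.
  exact: (code_gen (ltnSn i) (esym xy)).
have meval n A : saturated g n A ->
    measurable_fun [set: T] ((fun p : X * N => p.2 A) : T -> \bar R).
  move=> sA _ Y mY; rewrite setTI.
  by apply: (@cells_saturated n) => p q [_ h] /=; rewrite h//; exact: saturatedS sA.
have msnd : measurable_fun [set: T] (snd : T -> N).
  apply: measurable_fun_NmeasP => A mA.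
  have [B [X0B Bnd BT gB]] := g_lring.
  have mB k := lring_measurable (X0B k).
  (* Complements in the Dynkin induction become differences of masses, so all masses must be finite:
     hence the restriction to [B k]. Since [B k] is one of the [g i], the base case stays among
     saturated sets. *)
  have mevalB k : measurable_fun [set: T] ((fun p : X * N => p.2 (A `&` B k)) : T -> \bar R).
    have [i giB] := gB k.
    pose G := [set C | exists n, saturated g n C].
    have sBk n : (i < n)%N -> saturated g n (B k).
      by rewrite -giB; exact: saturated_gen.
    have GE : (d.-measurable : set (set X)) = <<s G >>.
      apply/seteqP; split => [C /g_gen|].
        apply: sub_sigma_algebra2 => _ [j _ <-].
        by exists j.+1; exact: saturated_gen.
      apply: smallest_sub; first exact: sigma_algebra_measurable.
      by move=> D [n /(measurable_saturated mg)].
    have : <<s G >> A by rewrite -GE.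
    move: A {mA}; apply: dynkin_induction => //.
    - move=> C D [n nC] [m mD]; exists (maxn n m); apply: saturatedI.
        by apply: saturatedS nC; exact: leq_maxl.
      by apply: saturatedS mD; exact: leq_maxr.
    - by rewrite setTI; apply: (@meval i.+1); exact: sBk.
    - move=> C [n nC]; apply: (@meval (maxn n i.+1)); apply: saturatedI.
        by apply: saturatedS nC; exact: leq_maxl.
      by apply: sBk; exact: leq_maxr.
    - move=> C mC IH.
      rewrite (_ : (fun p : X * N => _) = fun p => p.2 (B k) - p.2 (C `&` B k)).
        apply: emeasurable_funB => //.
        by apply: (@meval i.+1); exact: sBk.
      apply/funext => p; rewrite setIC -setDE measureD//; first by rewrite setIC.
      by rewrite ltey_eq Nmeas_fin_num.
    - move=> F mF tF IH.
      rewrite (_ : (fun p : X * N => _) = fun p => \sum_(n <oo) p.2 (F n `&` B k)).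
        exact: ge0_emeasurable_sum.
      apply/funext => p; rewrite setI_bigcupl measure_semi_bigcup//.
      + by move=> n; exact: measurableI.
      + exact: trivIset_setIr.
      + by apply: bigcupT_measurable => n; exact: measurableI.
  apply: (emeasurable_fun_cvg (fun k (p : T) => p.2 (A `&` B k))) => // p _.
  rewrite -[X in p.2 X](setIT A) -BT setI_bigcupr.
  apply: nondecreasing_cvg_mu => //.
  - by move=> k; exact: measurableI.
  - by apply: bigcup_measurable => k _; exact: measurableI.
  - move=> n m nm; rewrite subsetEset; apply: setIS.
    exact: (homo_leq (@subset_refl _) (fun _ _ _ => @subset_trans _ _ _ _) Bnd).
rewrite measurable_prod_measurableType; move: V; apply: smallest_sub.
  exact: smallest_sigma_algebra.
move=> _ [A mA [C mC <-]].
rewrite (_ : A `*` C = fst @^-1` A `&` snd @^-1` C)//.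
apply: (@measurableI _ T).
- by have := mfst measurableT A mA; rewrite setTI.
- by have := msnd measurableT C mC; rewrite setTI.
Qed.

End cells.

(** * The Mecke equation *)

Section poisson_recurrence.
Context {d} {Om : measurableType d} {R : realType} (P : probability Om R).

Lemma poisson_prob_recurrence (s : R) n : (0 <= s)%R ->
  n.+1%:R%:E * poisson_prob s 0%N [set n.+1] = s%:E * poisson_prob s 0%N [set n].
Proof.
rewrite le_eqVlt => /predU1P[<-|s0].
  by rewrite /poisson_prob ltxx mul0e !diracE/= memNset ?mule0.
rewrite /poisson_prob s0 !esum_set1 ?lee_fin ?poisson_pmf_ge0//.
rewrite /poisson_pmf s0 -!EFinM; congr EFin.
rewrite factS natrM exprS; field.
by rewrite pnatr_eq0 -lt0n fact_gt0 lt0r_neq0.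
Qed.

(** Dropping the zero term and shifting the index, the recurrence turns the sum of n p_n into s
    times the total mass. *)
Lemma poisson_mean (Y : Om -> \bar R) (s : R) :
  measurable_fun setT Y -> (forall w, exists n : nat, Y w = n%:R%:E) ->
  poisson_distributed P Y s%:E -> \int[P]_w Y w = s%:E.
Proof.
move=> mY Ynat [s0 Ys].
pose F n := [set w | Y w = n%:R%:E].
have mF n : measurable (F n).
  by rewrite -[F n]setTI; exact: (mY measurableT [set n%:R%:E]).
have FT : setT = \bigcup_n F n.
  by apply/seteqP; split => // w _; have [n Yn] := Ynat w; exists n.
have tF : trivIset setT F.
  move=> i j _ _ [w []]; rewrite /F /= => -> [] /eqP.
  by rewrite eqr_nat => /eqP.
rewrite FT ge0_integral_bigcup//; last 2 first.
- by rewrite -FT.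
- by move=> w _; have [n ->] := Ynat w; rewrite lee_fin.
transitivity (\sum_(0 <= n <oo) n%:R%:E * poisson_prob s 0%N [set n]).
  apply: eq_eseriesr => n _; rewrite -Ys -integral_cst; last exact: mF.
  by apply: eq_integral => w; rewrite inE.
have term_ge0 n : 0 <= n%:R%:E * poisson_prob s 0%N [set n].
  by rewrite mule_ge0// lee_fin.
rewrite nneseries_recl// mul0e add0e -nneseries_addn//=.
under eq_eseriesr do rewrite addn1 poisson_prob_recurrence//.
rewrite nneseriesZl// -[RHS]mule1; congr (_ * _).
rewrite -(@probability_setT _ _ _ (poisson_prob s 0%N)).
rewrite -measure_semi_bigcup//=.
- by congr (poisson_prob _ _ _); apply/seteqP; split => // n _; exists n.
- by move=> i j _ _ [k [-> ->]].
Qed.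

(** The mean replaces the rate because a Poisson process prescribes its intensity. An infinite rate
    is impossible: all mass would sit at a value that [Y] never takes. *)
Lemma poisson_distributed_recurrence (Y : Om -> \bar R) r n :
  measurable_fun setT Y -> (forall w, exists n : nat, Y w = n%:R%:E) ->
  poisson_distributed P Y r ->
  n.+1%:R%:E * P [set w | Y w = n.+1%:R%:E] =
  (\int[P]_w Y w) * P [set w | Y w = n%:R%:E].
Proof.
move=> mY Ynat Yr; have [s rs] : exists s, r = s%:E.
  move: Yr; case: r => [s||]//=; first by exists s.
  rewrite (_ : mkset _ = set0) ?measure0; first by move/eqP; rewrite eq_sym onee_eq0.
  by apply/seteqP; split => // w /=; have [m ->] := Ynat w.
subst r; rewrite (poisson_mean mY Ynat Yr).
by have [s0 Ys] := Yr; rewrite !Ys poisson_prob_recurrence.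
Qed.

End poisson_recurrence.

Section mecke.
Context {d} {X : measurableType d} (X0 : localising_ring X) {R : realType}
  {d'} {Om : measurableType d'} (P : probability Om R).
Variables (lambda : {measure set X -> \bar R}) (eta : Om -> Nmeas X0 R).
Hypotheses (hX : borel_space R X) (flambda : locally_finite X0 lambda)
  (heta : poisson_process P lambda eta).
Local Notation N := (Nmeas X0 R).
Local Notation delta := (diracN X0 R).

Let measurable_eta : measurable_fun setT eta.
Proof. exact: poisson_process_measurable heta. Qed.

Let measurable_etaE B : measurable B -> measurable_fun setT (fun w => eta w B).
Proof. by move=> mB; exact: (measurableT_comp (measurable_fun_eval mB)). Qed.

Let measurable_etaB B y : measurable B -> measurable [set w | eta w B = y].
Proof.
move=> mB; rewrite -[X in measurable X]setTI.
exact: (measurable_etaE mB measurableT (emeasurable_set1 y)).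
Qed.

Lemma poisson_process_indep_atoms n (B : 'I_n -> set X) (y : 'I_n -> \bar R) :
  (forall i, measurable (B i)) -> trivIset setT B ->
  P [set w | forall i, eta w (B i) = y i] =
  \prod_i P [set w | eta w (B i) = y i].
Proof.
move=> mB tB; have := poisson_process_indep heta mB tB (fun i => emeasurable_set1 (y i)).
move=> /= <-; congr (P _); apply/seteqP; split => w /=.
  by move=> h i _; exact: h.
by move=> h i; exact: (h i).
Qed.

Lemma poisson_process_recurrence a n : X0 a ->
  n.+1%:R%:E * P [set w | eta w a = n.+1%:R%:E] =
  lambda a * P [set w | eta w a = n%:R%:E].
Proof.
move=> X0a; have ma := lring_measurable X0a.
have [r ar] := poisson_process_distr heta ma.
rewrite -(poisson_process_mean heta ma).
apply: poisson_distributed_recurrence ar; first exact: measurable_etaE.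
by move=> w; exact: Nmeas_nat.
Qed.

Section cell.
Variable g : (set X)^nat.
Hypothesis mg : forall n, measurable (g n).

(** The point z ranges over one atom [a], and the condition on the counts is the same for all z in
    it. So the left side is [q.2 a] times P([C]) and the right side is [lambda a] times P([C']),
    where [C'] asks for one point less in [a]. By independence both probabilities are products over
    atoms that differ in the factor of [a] alone, and there the Poisson recurrence applies. *)
Lemma mecke_cell n (q : X * N) : X0 (bincode g n @^-1` [set bincode g n q.1]) ->
  \int[P]_w eta w [set z | same_cell g n (z, eta w) q] =
  \int[P]_w lambda [set z | same_cell g n (z, addN (eta w) (delta z)) q].
Proof.
set a := bincode g n @^-1` _ => X0a.
have ma := lring_measurable X0a.
pose i0 := Ordinal (bincode_lt g n q.1).
pose atom (i : 'I_(2 ^ n)) : set X := bincode g n @^-1` [set val i].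
have matom i : measurable (atom i) by exact: measurable_code.
have tatom : trivIset setT atom by move=> i j _ _ [x []]; rewrite /atom /= => -> /val_inj.
have fdirac A : \d_(q.1) A \is a @fin_num R by rewrite diracE.
pose y i := q.2 (atom i); pose c i : \bar R := \d_(q.1) (atom i).
pose C := [set w | forall i, eta w (atom i) = y i].
pose C' := [set w | forall i, eta w (atom i) = y i - c i].
have mC (z : 'I_(2 ^ n) -> \bar R) :
    measurable [set w | forall i, eta w (atom i) = z i].
  rewrite (_ : mkset _ = \bigcap_(i in [set: 'I_(2 ^ n)])
      [set w | eta w (atom i) = z i]).
    apply: fin_bigcap_measurable => // i _; exact: measurable_etaB.
  by apply/seteqP; split => w h i; [move=> _; exact: h|exact: (h i)].
have CE w : C w <-> forall A, saturated g n A -> eta w A = q.2 A.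
  split=> [Cw A sA|h i]; last by apply: h; exact: preimage_saturated.
  rewrite (saturated_preimage sA) (measure_code mg) [RHS](measure_code mg).
  by apply: eq_bigr => i _; exact: Cw.
have C'E w z : a z ->
    C' w <-> forall A, saturated g n A -> addN (eta w) (delta z) A = q.2 A.
  move=> az; have dE A : saturated g n A -> \d_z A = \d_(q.1) A :> \bar R.
    move=> sA; rewrite !diracE; congr (_%:R%:E); congr nat_of_bool.
    by apply/idP/idP; rewrite !inE; apply: sA.
  have yE (A : set X) : eta w A = q.2 A - \d_(q.1) A <->
      eta w A + \d_(q.1) A = q.2 A.
    by split=> [->|<-]; [rewrite subeK|rewrite addeK].
  split=> [Cw A sA|h i].
    rewrite addNE /= dE// (saturated_preimage sA) (measure_code mg).
    rewrite [X in _ + X](measure_code mg) [RHS](measure_code mg) -big_split/=.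
    by apply: eq_bigr => i _; apply/yE; exact: Cw.
  apply/yE; have sA := @preimage_saturated _ g n [set val i].
  by have := h _ sA; rewrite addNE/= dE.
transitivity (q.2 a * P C).
  rewrite -integral_cst//; last exact: mC.
  rewrite [RHS]integral_mkcond; apply: eq_integral => w _; rewrite patchE.
  have [Cw|Cw] := asboolP (C w).
    rewrite mem_set// (_ : mkset _ = a).
      by have /CE -> := Cw => //; exact: preimage_saturated.
    by apply/seteqP; split => z; [case|move=> az; split => //; exact/CE].
  rewrite memNset// (_ : mkset _ = set0) ?measure0//.
  by apply/seteqP; split => z // -[_ /CE].
transitivity (lambda a * P C'); last first.
  rewrite -integral_cst//; last exact: mC.
  rewrite [LHS]integral_mkcond; apply: eq_integral => w _; rewrite patchE.
  have [Cw|Cw] := asboolP (C' w).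
    rewrite mem_set//; congr (lambda _).
    by apply/seteqP; split => z; [move=> az; split => //; exact/(C'E w z)|case].
  rewrite memNset// (_ : mkset _ = set0) ?measure0//.
  by apply/seteqP; split => z // -[az]; move/(C'E w z az).
rewrite !poisson_process_indep_atoms//.
rewrite (bigD1 i0)// [in RHS](bigD1 i0)// !muleA; congr (_ * _).
  have -> : c i0 = 1 by rewrite /c diracE mem_set.
  rewrite /y (_ : atom i0 = a)//.
  have [m ->] := Nmeas_nat q.2 X0a.
  (* If [q.2] has no mass on [a], the left factor is 0 and the event on the right asks for a count
     of -1, hence is empty. *)
  case: m => [|m].
    rewrite mul0e (_ : mkset _ = set0) ?measure0 ?mule0//.
    apply/seteqP; split => // w /= h.
    by have : 0 <= eta w a by []; rewrite h lee_fin sub0r ler0N1.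
  rewrite poisson_process_recurrence//; congr (_ * P _).
  by apply/seteqP; split => w /= ->; rewrite -EFinB -natr1 addrK.
apply: eq_bigr => i ii0; rewrite /c diracE memNset ?sube0// => ai.
by move/eqP: ii0; apply; exact/val_inj.
Qed.

End cell.

Let measurable_phi1 : measurable_fun setT (fun p : Om * X => (p.2, eta p.1)).
Proof.
apply: measurable_fun_pair => //.
exact: (measurableT_comp measurable_eta measurable_fst).
Qed.

Let measurable_phi2 : measurable_fun setT
  (fun p : Om * X => (p.2, addN (eta p.1) (delta p.2))).
Proof.
apply: measurable_fun_pair => //; apply: measurable_fun_addN.
- exact: (measurableT_comp measurable_eta measurable_fst).
- exact: (measurableT_comp (@measurable_fun_diracN _ _ X0 R) measurable_snd).
Qed.

(** Both sides integrate [G] against a measure on X x N. Over a ring set [E j] of the partition both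
    measures have the finite mass [lambda (E j)], so agreement on cells is enough. *)
Lemma mecke (G : X * N -> \bar R) :
  (forall p, 0 <= G p) -> measurable_fun setT G ->
  \int[P]_w \int[eta w]_z G (z, eta w) =
  \int[P]_w \int[lambda]_z G (z, addN (eta w) (delta z)).
Proof.
move=> G0 mG.
have [k1 k1E] := Nmeas_sfkernel (measurableT_comp measurable_eta
  (measurable_snd : measurable_fun [set: unit * Om] snd)).
have [k2 k2E] := @locally_finite_sfkernel _ _ (unit * Om)%type _ _ _ _ flambda.
have [C1 C1E] := campbell_measure P
  (fun w U mU => k1E (tt, w) U mU) measurable_phi1.
have [C2 C2E] := campbell_measure P (kappa := fun=> lambda)
  (fun w U mU => k2E (tt, w) U mU) measurable_phi2.
have mphi (phi : Om * X -> X * N) w V : measurable_fun setT phi ->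
    measurable V -> measurable [set z | V (phi (w, z))].
  move=> mphi mV; rewrite -[X in measurable X]setTI.
  exact: (measurableT_comp mphi (measurable_pair1 w)).
have C1V V : measurable V -> C1 V = \int[P]_w eta w [set z | V (z, eta w)].
  move=> mV; rewrite -[V in LHS]setIT -integral_indic// C1E//.
    apply: eq_integral => w _; rewrite -[X in eta w X]setIT -integral_indic//.
    exact: (mphi _ w V measurable_phi1).
  exact/measurable_EFinP.
have C2V V : measurable V ->
    C2 V = \int[P]_w lambda [set z | V (z, addN (eta w) (delta z))].
  move=> mV; rewrite -[V in LHS]setIT -integral_indic// C2E//.
    apply: eq_integral => w _; rewrite -[X in lambda X]setIT -integral_indic//.
    exact: (mphi _ w V measurable_phi2).
  exact/measurable_EFinP.
suff C12 V : measurable V -> C1 V = C2 V.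
  rewrite -C1E// -C2E//; apply: eq_measure_integral => V mV _; exact: C12.
move=> mV; have [E [X0E tE ET]] := lring_partition X0.
have mE n := lring_measurable (X0E n).
pose ET' n : set (X * N) := E n `*` setT.
have mET n : measurable (ET' n) by exact: measurableX.
have tET : trivIset setT ET'.
  by move=> i j _ _ [p [[pi _] [pj _]]]; apply: (tE i j) => //; exists p.1.
have ETT : \bigcup_n ET' n = setT.
  apply/seteqP; split => // p _; have : setT p.1 by [].
  by rewrite -ET => -[n _ En]; exists n.
rewrite (measure_partition C1 mET tET ETT mV) (measure_partition C2 mET tET ETT mV).
apply: eq_eseriesr => j _.
have [h [mh h_gen _]] := borel_space_generators hX.
have [B [X0B Bnd BT _]] := lring_exhaustion X0.
(* With [E j] as [g 0], every cell of level at least 1 has all its points in [E j] or none of them.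
   The later indices interleave the exhausting sets, which keep masses finite, with the countable
   generators. *)
pose g n : set X := if n is m.+1 then
    match (unpickle m : option (nat + rat)) with
    | Some (inl k) => B k | Some (inr r) => h r | None => set0 end
  else E j.
have gS m : g m.+1 = match (unpickle m : option (nat + rat)) with
    | Some (inl k) => B k | Some (inr r) => h r | None => set0 end by [].
have mg n : measurable (g n).
  case: n => [|n]; first exact: mE.
  rewrite gS; case: unpickle => [[k|r]|]//; exact: lring_measurable.
have g_gen : measurable `<=` <<s range g >>.
  move=> A /h_gen; apply: sub_sigma_algebra2 => _ [r _ <-].
  by exists (pickle (inr r : nat + rat)).+1; [|rewrite gS pickleK].
have g_lring : exists B : (set X)^nat, [/\ forall n, X0 (B n),
     forall n, B n `<=` B n.+1, \bigcup_n B n = setT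
   & forall n, exists i, g i = B n].
  exists B; split => // k; exists (pickle (inl k : nat + rat)).+1.
  by rewrite gS pickleK.
have C1T : C1 (ET' j) = lambda (E j).
  rewrite C1V// -(poisson_process_mean heta (mE j)); apply: eq_integral => w _.
  by congr (eta w _); apply/seteqP; split => z // [].
have C2T : C2 (ET' j) = lambda (E j).
  rewrite C2V// -[RHS]mule1 -(probability_setT P) -integral_cst//.
  apply: eq_integral => w _.
  by congr (lambda _); apply/seteqP; split => z // [].
rewrite -/(mrestr C1 (mET j) V) -/(mrestr C2 (mET j) V).
have := (@measure_unique _ _ _ (@cells _ _ X0 R g) (fun=> setT) _ _ _ _
  (mrestr C1 (mET j)) (mrestr C2 (mET j)) _ _ V mV); apply => //.
- apply/seteqP; split; first exact: measurable_cells.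
  apply: smallest_sub; first exact: sigma_algebra_measurable.
  by move=> _ [->//|[->//|[n [q ->]]]]; exact: measurable_cell.
- exact: setI_closed_cells.
- by move=> _; right; left.
- by apply/seteqP; split => // p _; exists 0%N.
- move=> _ [->|[->|[n [q ->]]]]; rewrite /= /mrestr ?set0I ?measure0//.
    by rewrite setTI C1T C2T.
  have gE : g 0%N = E j by [].
  have [Eq|Eq] := pselect (E j q.1).
    have -> : cell g n.+1 q `&` ET' j = cell g n.+1 q.
      apply/setIidPl => p [pq _]; split => //.
      by rewrite -gE; apply: (code_gen _ (esym pq)) => //.
    have mcell := measurable_cell mg n.+1 q.
    rewrite C1V// C2V//; apply: mecke_cell => //.
    have -> : bincode g n.+1 @^-1` [set bincode g n.+1 q.1] =
        E j `&` bincode g n.+1 @^-1` [set bincode g n.+1 q.1].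
      apply/esym/setIidPr => x xq; rewrite -gE.
      by apply: (code_gen _ (esym xq)).
    by apply: lring_setI => //; exact: measurable_code.
  rewrite (_ : _ `&` _ = set0) ?measure0//.
  apply/seteqP; split => // p [[pq _] [Ep _]]; apply: Eq.
  by rewrite -gE; apply: (code_gen _ pq).
- by move=> _; rewrite /= /mrestr setTI C1T; exact: flambda.
Qed.

End mecke.

(** * Atoms *)

Section atoms.
Context {d} {X : measurableType d} (X0 : localising_ring X) (R : realType).
Hypothesis hX : borel_space R X.
Local Notation N := (Nmeas X0 R).
Local Notation delta := (diracN X0 R).
Implicit Types (mu nu rho : N) (z : X).

Lemma lring_set1 z : X0 [set z].
Proof.
have [B [X0B _ BT _]] := lring_exhaustion X0.
have [n _ Bz] : (\bigcup_n B n) z by rewrite BT.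
rewrite (_ : [set z] = B n `&` [set z]); last by rewrite setIC; apply/esym/setIidPl => _ ->.
by apply: lring_setI => //; exact: (borel_space_set1 hX).
Qed.

Lemma suppE mu z : supp mu z <-> 1 <= mu [set z].
Proof. by rewrite /supp /= Nmeas_gt0//; exact: (borel_space_set1 hX). Qed.

Lemma suppN mu z : ~ supp mu z <-> mu [set z] = 0.
Proof.
rewrite /supp /= lt0e measure_ge0 andbT; split=> [/negP|->]; last first.
  by rewrite eqxx.
by rewrite negbK => /eqP.
Qed.

Lemma measle_diracN mu z : supp mu z -> measle (delta z) mu.
Proof.
move=> /suppE muz B mB; rewrite /= diracE.
have [zB|_] := boolP (z \in B); last exact: measure_ge0.
apply: (le_trans muz); apply: le_measure; rewrite ?inE//.
  exact: (borel_space_set1 hX).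
by move=> _ ->; rewrite inE in zB.
Qed.

(** The mass of {z} is the integral over x of the indicator of x = z. As the diagonal is measurable,
    this integral is jointly measurable in z and the measure. *)
Lemma measurable_supp_graph : measurable [set p : X * N | supp p.2 p.1].
Proof.
pose S := [set t : (X * N) * X | t.2 = t.1.1].
have mS : measurable S.
  rewrite -[X in measurable X]setTI.
  have mpair : measurable_fun setT (fun t : (X * N) * X => (t.2, t.1.1)).
    apply: measurable_fun_pair => //.
    exact: (measurableT_comp measurable_fst measurable_fst).
  exact: (mpair measurableT _ (borel_space_diag hX)).
have m1S : measurable_fun setT (fun t : (X * N) * X => (\1_S t)%:E : \bar R).
  exact/measurable_EFinP/measurable_indic.
have mI : measurable_fun setT (fun p : X * N => \int[p.2]_x (\1_S (p, x))%:E).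
  exact: (measurable_fun_integral_Nmeas measurable_snd _ m1S).
rewrite (_ : mkset _ = setT `&` (fun p : X * N =>
    \int[p.2]_x (\1_S (p, x))%:E) @^-1` `]0, +oo[).
  by apply: mI => //; exact: emeasurable_itv.
rewrite setTI; apply/seteqP; split => -[z mu]/=; rewrite in_itv/= andbT.
all: have -> : (fun x : X => (\1_S (z, mu, x))%:E) = (fun x => (\1_[set z] x)%:E :> \bar R).
all: try by apply/funext => x; rewrite !indicE; congr (_%:R%:E);
  congr nat_of_bool; apply/idP/idP; rewrite !inE.
all: by rewrite integral_indic ?setIT//; exact: (borel_space_set1 hX).
Qed.

Lemma measurable_supp mu : measurable (supp mu).
Proof.
rewrite -[X in measurable X]setTI.
exact: (measurable_pair2 mu measurableT measurable_supp_graph).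
Qed.

(* A set of least positive mass is not split by any of the countably many
   generators, which separate points; so its mass sits at one point. *)
Lemma Nmeas_atomic mu A : measurable A -> A `&` supp mu = set0 -> mu A = 0.
Proof.
move=> mA Amu; apply: contrapT => muA0.
pose S n := `[< exists C, [/\ measurable C, C `<=` A & mu C = n.+1%:R%:E] >].
have exS : exists n, S n.
  have [E [X0E tE ET]] := lring_partition X0.
  have mE n := lring_measurable (X0E n).
  apply: contrapT => noS; apply: muA0; rewrite (measure_partition mu mE tE ET mA).
  apply: eseries0 => n _ _.
  have X0AE : X0 (A `&` E n) by rewrite setIC; exact: lring_setI.
  have [[|m] muAE] := Nmeas_nat mu X0AE; first by [].
  exfalso; apply: noS; exists m.
  apply/asboolP; exists (A `&` E n); split => //; exact: measurableI.
case: (ex_minnP exS) => n /asboolP[C [mC CA muC]] minn.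
have [h [mh _ h_sep]] := borel_space_generators hX.
have Cnat (B : set X) : measurable B -> mu (C `&` B) = 0 \/ mu (C `&` B) = mu C.
  move=> mB; have mCB : measurable (C `&` B) by exact: measurableI.
  have leC : mu (C `&` B) <= mu C by apply: le_measure; rewrite ?inE.
  have [CB|[[|m] CB]] := Nmeas_natP mu mCB; [|by left|right].
    by move: leC; rewrite CB muC.
  apply/eqP; rewrite eq_le leC/= muC CB lee_fin ler_nat ltnS; apply: minn.
  by apply/asboolP; exists (C `&` B); split => // x [/CA].
(* By minimality each [h q] takes either none or all of the mass of [C]; [F q] is the side of mass
   0. Points of [C] outside every [F q] lie in the same generators, hence coincide. *)
pose F q := if mu (C `&` h q) == 0 then h q else ~` h q.
have mF q : measurable (F q).
  by rewrite /F; case: ifPn => _ //; exact: measurableC.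
have F0 q : mu (C `&` F q) = 0.
  rewrite /F; case: ifPn => [/eqP//|nh].
  have [h0|hC] := Cnat _ (mh q); first by rewrite h0 eqxx in nh.
  rewrite -setDE (Nmeas_measureD mC (mh q)); last by rewrite muC ltry.
  by rewrite hC muC subee.
pose U := \bigcup_q F q.
have mU : measurable U by exact: bigcupT_measurable_rat.
have U0 : mu (C `&` U) = 0.
  apply/eqP; rewrite eq_le measure_ge0 andbT.
  pose F' k := if unpickle k is Some q then C `&` F q else set0.
  have mF' k : measurable (F' k).
    by rewrite /F'; case: unpickle => // q; exact: measurableI.
  have -> : C `&` U = \bigcup_k F' k.
    rewrite setI_bigcupr; apply/seteqP; split => [x [q _ CFx]|x [k _]].
      by exists (pickle q); [|rewrite /F' pickleK].
    by rewrite /F'; case: unpickle => // q CFx; exists q.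
  rewrite (le_trans (measure_sigma_subadditive mu mF' _ (@subset_refl _ _)))//.
    exact: bigcupT_measurable.
  rewrite eseries0// => k _ _; rewrite /F'; case: unpickle => [q|]; last exact: measure0.
  exact: F0.
have CU : mu (C `\` U) = n.+1%:R%:E.
  rewrite (Nmeas_measureD mC mU); last by rewrite muC ltry.
  by rewrite U0 muC sube0.
have [x [Cx Ux]] : C `\` U !=set0.
  apply/set0P/negP => /eqP CU0; move: CU; rewrite CU0 measure0 => /eqP.
  by rewrite eqe eq_sym pnatr_eq0.
have hF q y : ~ U y -> h q y <-> ~ mu (C `&` h q) = 0.
  move=> Uy; have : ~ F q y by move=> Fy; apply: Uy; exists q.
  by rewrite /F; case: eqP => h0; [tauto|move=> /contrapT; tauto].
suff sx : supp mu x by have : set0 x by rewrite -Amu; split => //; exact: CA.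
have CUE : C `\` U = [set x].
  apply/seteqP; split => [y [Cy Uy]|_ ->//]; apply: h_sep => q.
  by rewrite (hF q y)// (hF q x).
by rewrite /supp /= -CUE CU lte_fin.
Qed.

End atoms.

(** * Generators *)

Section generator_theory.
Context {d} {X : measurableType d} (X0 : localising_ring X) (R : realType).
Hypothesis hX : borel_space R X.
Variable D : Nmeas X0 R -> Nmeas X0 R.
Hypothesis hD : generator D.
Local Notation N := (Nmeas X0 R).
Local Notation delta := (diracN X0 R).
Implicit Types (mu nu rho : N) (z : X).

Let measurable1 z : measurable [set z] := borel_space_set1 hX z.

Lemma generator_measeq mu nu : measeq mu nu -> measeq (D mu) (D nu).
Proof.
move=> mn B mB; have mDB : measurable_fun setT (fun m => D m B).
  exact: (measurableT_comp (measurable_fun_eval mB) (generator_measurable hD)).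
have mS := mDB measurableT _ (emeasurable_set1 (D mu B)); rewrite setTI in mS.
exact/esym/(measeq_measurable mS mn).
Qed.

Lemma generatorK mu : measeq (D (D mu)) (D mu).
Proof.
have := @generator_idempotency _ _ _ _ _ hD mu (zeroN X0 R) (fun B _ => measure_ge0 _ B).
by apply: measeq_trans; apply: generator_measeq => B mB; rewrite addNE adde0.
Qed.

(** Additivity raises the mass at z by one, and this mass is finite. *)
Lemma generator_addN_neq mu z : supp (D mu) z ->
  ~ measeq (D (addN mu (delta z))) (D mu).
Proof.
move=> /(generator_additivity hD) h h'.
have := h _ (measurable1 z); rewrite h'// addNE /= diracE mem_set//.
have [n ->] := Nmeas_nat (D mu) (lring_set1 X0 hX z); rewrite -EFinD => -[] /eqP.
by rewrite natr1 eqr_nat; elim: n.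
Qed.

(** Since [nu] has no mass at z, thinning already gives nu <= mu. So mu - nu is a submeasure of mu +
    delta_z - nu, and idempotency at mu + delta_z says that nu + (mu - nu) = mu is sent to nu. *)
Lemma generator_addN_eq mu z : ~ supp (D (addN mu (delta z))) z ->
  measeq (D (addN mu (delta z))) (D mu).
Proof.
set nu := D _ => /suppN nuz.
have numu : measle nu mu.
  move=> B mB; have mBz : measurable (B `\` [set z]) by exact: measurableD.
  have nuBz : nu B = nu (B `\` [set z]).
    rewrite (Nmeas_measureDI nu mB (measurable1 z)).
    rewrite (_ : nu (B `&` [set z]) = 0) ?adde0//.
    apply/eqP; rewrite eq_le measure_ge0 andbT -nuz.
    by apply: le_measure; rewrite ?inE//; exact: measurableI.
  rewrite nuBz; apply: (le_trans (generator_thinning hD _ mBz)).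
  rewrite addNE /= diracE memNset ?adde0; last by case=> _; apply.
  by apply: le_measure; rewrite ?inE//; exact: subDsetl.
have rhoE := subNK numu.
have h : measle (subN mu nu) (subN (addN mu (delta z)) nu).
  apply: (measleD2r (rho := nu)) => B mB.
  rewrite rhoE// subNK; [|exact: generator_thinning|by []].
  by rewrite addNE leeDl.
have := @generator_idempotency _ _ _ _ _ hD (addN mu (delta z)) (subN mu nu) h.
move=> hnu; apply: (measeq_trans (measeq_sym hnu)).
by apply: generator_measeq => B mB; rewrite -rhoE// !addNE addeC.
Qed.

(** If z were retained and [D] unchanged, z would already lie in [D mu], and additivity would force
    a change. Replacing an equality of measures by membership of one point is also what makes [Hind]
    visibly measurable. *)
Lemma HindE z mu : Hind D z mu = `[< supp (D (addN mu (delta z))) z >]%:R :> R.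
Proof.
rewrite /Hind; congr (_%:R); congr nat_of_bool; apply/asboolP/asboolP.
  by move=> h; apply: contrapT => /generator_addN_eq.
move=> h h'; apply: (generator_addN_neq _ h').
by rewrite /supp /= -h'.
Qed.

(** Consistency applies to D mu <= mu, which have the same image under [D], with psi = delta_z. *)
Lemma Hind_generator z mu : Hind D z mu = Hind D z (D mu).
Proof.
rewrite !HindE; congr (`[< _ >]%:R); rewrite /supp /=.
rewrite (@generator_consistency _ _ _ _ _ hD mu (D mu))//.
- exact: generator_thinning.
- exact/measeq_sym/generatorK.
Qed.

Lemma Hind_subN z mu : supp mu z ->
  Hind D z (subN mu (delta z)) = `[< supp (D mu) z >]%:R.
Proof.
move=> muz; rewrite HindE; congr (`[< _ >]%:R); rewrite /supp /=.
rewrite (@generator_measeq _ mu)//.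
exact/subNK/measle_diracN.
Qed.

(** A common point z could be added to [D mu] without effect by idempotency, whereas additivity
    makes its addition visible because z lies in D (D mu). *)
Lemma generator_supp_disjoint mu :
  supp (subN mu (D mu)) `&` supp (D mu) = set0.
Proof.
apply/seteqP; split => // z [rz Dz].
have h := @generator_idempotency _ _ _ _ _ hD mu (delta z) (measle_diracN hX rz).
have DDz : supp (D (D mu)) z by rewrite /supp /= generatorK.
apply: (generator_addN_neq DDz) => B mB.
by rewrite h// generatorK.
Qed.

(** Atomicity enters twice: mu - D mu has no atom in the support of [D mu], hence no mass there, and
    [D mu] has no mass off its support. *)
Lemma generator_supp mu B : measurable B ->
  mu (B `&` supp (D mu)) = D mu B.
Proof.
move=> mB; have mS := measurable_supp hX (D mu).
have mBS : measurable (B `&` supp (D mu)) by exact: measurableI.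
rewrite -(subNK (generator_thinning hD mu) mBS) addNE.
rewrite (Nmeas_atomic hX mBS) ?add0e; last first.
  by rewrite -setIA [X in _ `&` X]setIC generator_supp_disjoint setI0.
rewrite (Nmeas_measureDI (D mu) mB mS).
rewrite (Nmeas_atomic hX (A := B `\` _)) ?add0e//; first exact: measurableD.
by apply/seteqP; split => // x [[]].
Qed.

End generator_theory.

(** * Conditional expectation *)

Section conditioning.
Context {d} {X : measurableType d} (X0 : localising_ring X) (R : realType)
  {d'} {Om : measurableType d'} (P : probability Om R).
Hypothesis hX : borel_space R X.
Variable D : Nmeas X0 R -> Nmeas X0 R.
Hypothesis hD : generator D.
Variables (lambda : {measure set X -> \bar R}) (eta : Om -> Nmeas X0 R).
Hypotheses (flambda : locally_finite X0 lambda)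
  (heta : poisson_process P lambda eta).
Local Notation N := (Nmeas X0 R).
Local Notation delta := (diracN X0 R).

Lemma integral_concentrated (mu : {measure set X -> \bar R}) A (f : X -> \bar R) :
  measurable A -> mu (~` A) = 0 -> measurable_fun setT f ->
  \int[mu]_x f x = \int[mu]_(x in A) f x.
Proof.
move=> mA muA mf; rewrite integralE [RHS]integralE.
have mAC : measurable (~` A) by exact: measurableC.
congr (_ - _).
- rewrite (ge0_negligible_integral mAC)//; last exact: measurable_funepos.
  by rewrite setTD setCK.
- rewrite (ge0_negligible_integral mAC)//; last exact: measurable_funeneg.
  by rewrite setTD setCK.
Qed.

Let supp0 (mu : N) : mu (~` supp mu) = 0 :> \bar R.
Proof.
apply: (Nmeas_atomic hX); last by rewrite setICl.
by apply: measurableC; exact: (measurable_supp hX).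
Qed.

Lemma integral_generator (mu : N) (f : X -> \bar R) : measurable_fun setT f ->
  \int[D mu]_x f x = \int[mu]_(x in supp (D mu)) f x.
Proof.
move=> mf; have mS := measurable_supp hX (D mu).
rewrite (integral_concentrated mS (supp0 _))//.
apply: eq_measure_integral => A mA AS.
by rewrite -(generator_supp hX hD)// ((setIidPl _ _).2 AS).
Qed.

Let hinds : set (X * N) := [set p | supp (D (addN p.2 (delta p.1))) p.1].

Let measurable_hinds : measurable hinds.
Proof.
have m : measurable_fun setT (fun p : X * N => (p.1, D (addN p.2 (delta p.1)))).
  apply: measurable_fun_pair => //.
  apply: (measurableT_comp (generator_measurable hD)).
  apply: measurable_fun_addN => //.
  exact: (measurableT_comp (@measurable_fun_diracN _ _ X0 R) measurable_fst).
have := m measurableT _ (measurable_supp_graph hX).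
by rewrite setTI.
Qed.

Let Hind_indic z mu : Hind D z mu = \1_hinds (z, mu).
Proof.
by rewrite (HindE hX hD) indicE; congr (nat_of_bool _)%:R.
Qed.

Lemma measurable_fun_Hind :
  measurable_fun setT (fun p : X * N => Hind D p.1 p.2).
Proof.
rewrite (_ : (fun p => _) = \1_hinds); first exact: (measurable_indic measurable_hinds).
by apply/funext => -[z mu]; rewrite Hind_indic.
Qed.

Lemma integral_Hind_subN (mu : N) (f : X -> R) : measurable_fun setT f ->
  \int[mu]_z (f z * Hind D z (subN mu (delta z)))%:E = \int[D mu]_z (f z)%:E.
Proof.
move=> mf; have mS := measurable_supp hX mu.
have mDS := measurable_supp hX (D mu).
have DS : supp (D mu) `<=` supp mu.
  move=> z; rewrite /supp /= => /lt_le_trans; apply.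
  exact: (generator_thinning hD _ (borel_space_set1 hX z)).
rewrite (integral_concentrated mS (supp0 _))//; last first.
  (* Off the support of [mu] no measure plus delta_z gives [mu], so [subN] takes its default
     [zeroN]. This describes the integrand everywhere, as its measurability requires. *)
  rewrite (_ : (fun z => _) = fun z => if z \in supp mu
      then (f z * \1_(supp (D mu)) z)%:E else (f z * Hind D z (zeroN X0 R))%:E).
    apply: measurable_fun_if => //.
    - apply: (measurable_fun_bool true).
      rewrite setTI (_ : _ @^-1` _ = supp mu)//.
      by apply/seteqP; split => z /=; [exact: set_mem|exact: mem_set].
    - apply: measurable_funTS; apply/measurable_EFinP; apply: measurable_funM => //.
    - apply: measurable_funTS; apply/measurable_EFinP; apply: measurable_funM => //.
      exact: (measurableT_comp measurable_fun_Hind (measurable_pair2 (zeroN X0 R))).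
  apply/funext => z; case: ifPn => [/set_mem zmu|/negP zmu].
    by rewrite (Hind_subN hX hD zmu) indicE; congr (_ * (nat_of_bool _)%:R)%:E.
  rewrite /subN; case: xgetP => // rho _ /(_ _ (borel_space_set1 hX z)).
  rewrite addNE /= diracE mem_set// => muz; case: zmu; apply/mem_set/suppE => //.
  by rewrite -muz leeDr.
rewrite integral_generator; last exact/measurable_EFinP.
rewrite -((setIidPr _ _).2 DS) integral_mkcondr.
apply: eq_integral => z /set_mem zmu; rewrite (Hind_subN hX hD zmu) patchE.
case: (asboolP (supp (D mu) z)) => h; first by rewrite mem_set// mulr1.
by rewrite memNset// mulr0.
Qed.

(* [cmean f (D (eta w))] is a version of the conditional expectation of
   [\int[eta w]_x f x] given [D \o eta]. *)
Definition cmean (f : X -> \bar R) (nu : N) : \bar R :=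
  \int[nu]_x f x + \int[lambda]_z ((1 - Hind D z nu)%:E * f z).

Lemma subr_Hind_itv z nu : (0 <= 1 - Hind D z nu <= 1)%R.
Proof. by rewrite /Hind; case: asboolP => _; rewrite ?subrr ?subr0 ler01 lexx. Qed.

Let measurable_coHind (f : X -> \bar R) : measurable_fun setT f ->
  measurable_fun setT (fun p : N * X => (1 - Hind D p.2 p.1)%:E * f p.2).
Proof.
move=> mf; apply: emeasurable_funM.
  apply/measurable_EFinP; apply: measurable_funB => //.
  have mswap : measurable_fun setT (fun p : N * X => (p.2, p.1)).
    exact: measurable_fun_pair.
  exact: (measurableT_comp measurable_fun_Hind mswap).
exact: measurableT_comp.
Qed.

Lemma measurable_cmean (f : X -> \bar R) :
  measurable_fun setT f -> (forall x, 0 <= f x) -> measurable_fun setT (cmean f).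
Proof.
move=> mf f0; apply: emeasurable_funD.
- apply: (@measurable_fun_integral_Nmeas _ _ _ _ _ _ idfun (fun p => f p.2)) => //.
    exact: measurable_id.
  exact: (measurableT_comp mf measurable_snd).
- apply: (@measurable_fun_integral_locally_finite _ _ _ _ _ _ lambda
    (fun p : N * X => (1 - Hind D p.2 p.1)%:E * f p.2)) => //.
  + exact: flambda.
  + by move=> p /=; apply: mule_ge0 => //; rewrite lee_fin; case/andP: (subr_Hind_itv p.2 p.1).
  + exact: measurable_coHind.
Qed.

Let measurable_eta : measurable_fun setT eta.
Proof. exact: poisson_process_measurable heta. Qed.

Let measurable_Deta : measurable_fun setT (D \o eta).
Proof. exact: (measurableT_comp (generator_measurable hD) measurable_eta). Qed.

Lemma integral_generatorD (mu : N) (f : X -> \bar R) :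
  measurable_fun setT f -> (forall x, 0 <= f x) ->
  \int[mu]_x f x =
  \int[D mu]_x f x + \int[mu]_z ((\1_(~` supp (D mu)) z)%:E * f z).
Proof.
move=> mf f0; have mS := measurable_supp hX (D mu).
rewrite integral_generator// -[in LHS](setUv (supp (D mu))) ge0_integral_setU//.
- congr (_ + _); rewrite integral_mkcond; apply: eq_integral => z _.
  by rewrite patchE indicE; case: ifPn => _; rewrite ?mul1e ?mul0e.
- exact: measurableC.
- by rewrite setUv.
- by apply/disj_setPS; rewrite setICr.
Qed.

(** The integral over [D mu] appears on both sides, so only the points discarded by [D] remain.
    After the Mecke equation their indicator says that the added z is discarded, which is 1 - H_z;
    then [D] is unchanged, and the event is again that [D] of [eta] lies in [A]. *)
Lemma integral_cmean (f : X -> \bar R) (A : set N) :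
  measurable_fun setT f -> (forall x, 0 <= f x) -> measurable A ->
  \int[P]_(w in (D \o eta) @^-1` A) \int[eta w]_x f x =
  \int[P]_(w in (D \o eta) @^-1` A) cmean f (D (eta w)).
Proof.
move=> mf f0 mA; set B := _ @^-1` A.
have mB : measurable B.
  by rewrite -[B]setTI; exact: measurable_Deta.
pose T := [set p : X * N | A (D p.2) /\ ~ supp (D p.2) p.1].
have mD2 : measurable_fun setT (fun p : X * N => (p.1, D p.2)).
  apply: measurable_fun_pair => //.
  exact: (measurableT_comp (generator_measurable hD) measurable_snd).
have mT : measurable T.
  rewrite (_ : T = setT `&` (fun p : X * N => (p.1, D p.2)) @^-1`
      ((setT `*` A) `&` ~` [set p : X * N | supp p.2 p.1])).
    apply: mD2 => //; apply: measurableI; first exact: measurableX.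
    by apply: measurableC; exact: (measurable_supp_graph hX).
  by rewrite setTI; apply/seteqP; split => [p [? ?]|p [[_ ?] ?]]; split.
pose G p := (\1_T p)%:E * f p.1.
have G0 p : 0 <= G p by apply: mule_ge0.
have mG : measurable_fun setT G.
  apply: emeasurable_funM; first exact/measurable_EFinP/measurable_indic.
  exact: (measurableT_comp mf measurable_fst).
have mgen : measurable_fun setT (fun w => \int[D (eta w)]_x f x).
  apply: (@measurable_fun_integral_Nmeas _ _ _ _ _ _ _ (fun p : Om * X => f p.2)) => //.
  exact: (measurableT_comp mf measurable_snd).
have mcoH : measurable_fun setT (fun w =>
    \int[lambda]_z ((1 - Hind D z (D (eta w)))%:E * f z)).
  have := @measurable_fun_integral_locally_finite _ _ N _ _ _ lambda
    (fun p => (1 - Hind D p.2 p.1)%:E * f p.2) flambda.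
  move=> mI; apply: (measurableT_comp (mI _ _) measurable_Deta).
  + by move=> p /=; apply: mule_ge0 => //; rewrite lee_fin; case/andP: (subr_Hind_itv p.2 p.1).
  + exact: measurable_coHind.
have msupp : measurable_fun setT (fun w =>
    \int[eta w]_z ((\1_(~` supp (D (eta w))) z)%:E * f z)).
  pose g (p : Om * X) := (\1_(~` [set p : X * N | supp p.2 p.1])
    (p.2, D (eta p.1)))%:E * f p.2.
  have mg : measurable_fun setT g.
    apply: emeasurable_funM; last exact: (measurableT_comp mf measurable_snd).
    apply/measurable_EFinP.
    have mi : measurable_fun setT
        (\1_(~` [set p : X * N | supp p.2 p.1]) : X * N -> R).
      by apply/measurable_indic/measurableC; exact: (measurable_supp_graph hX).
    apply: (measurableT_comp mi); apply: measurable_fun_pair => //.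
    exact: (measurableT_comp measurable_Deta measurable_fst).
  apply: (measurable_fun_integral_Nmeas measurable_eta _ mg) => p.
  by apply: mule_ge0.
rewrite /cmean; under eq_integral do rewrite integral_generatorD//.
have integral_ge0' (mu : {measure set X -> \bar R}) (h : X -> R) :
    (forall z, 0 <= h z)%R -> 0 <= \int[mu]_z ((h z)%:E * f z).
  by move=> h0; apply: integral_ge0 => z _; apply: mule_ge0 => //; rewrite lee_fin.
have coH0 w z : (0 <= 1 - Hind D z (D (eta w)))%R.
  by case/andP: (subr_Hind_itv z (D (eta w))).
have gen0 w : 0 <= \int[D (eta w)]_x f x by exact: integral_ge0.
have mB' (h : Om -> \bar R) : measurable_fun setT h -> measurable_fun B h.
  exact: measurable_funTS.
rewrite [LHS]ge0_integralD//; [|exact: mB'|by move=> w _; exact: integral_ge0'|exact: mB'].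
rewrite [RHS]ge0_integralD//; [|exact: mB'|by move=> w _; exact: integral_ge0'|exact: mB'].
congr (_ + _).
transitivity (\int[P]_w \int[eta w]_z G (z, eta w)).
  rewrite integral_mkcond; apply: eq_integral => w _; rewrite patchE.
  case: ifPn => [/set_mem Bw|/negP Bw].
    apply: eq_integral => z _; rewrite /G !indicE; congr ((nat_of_bool _)%:R%:E * _).
    by apply/idP/idP => /set_mem h; apply/mem_set => //; case: h.
  rewrite integral0_eq// => z _; rewrite /G indicE memNset ?mul0e//.
  by case=> Az _; apply: Bw; exact/mem_set.
rewrite (mecke hX flambda heta G0 mG) [RHS]integral_mkcond.
apply: eq_integral => w _; rewrite patchE.
have Teq z : T (z, addN (eta w) (delta z)) ->
    measeq (D (addN (eta w) (delta z))) (D (eta w)).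
  by case=> _ /(generator_addN_eq hX hD).
case: ifPn => [/set_mem Bw|/negP Bw].
  apply: eq_integral => z _; rewrite /G indicE; congr (_%:E * _).
  rewrite -(Hind_generator hX hD) (HindE hX hD).
  case: asboolP => [h|h]; first by rewrite subrr memNset//; case.
  rewrite subr0 mem_set//; split => //.
  apply: (measeq_measurable mA _ Bw); apply/measeq_sym.
  exact: (generator_addN_eq hX hD).
rewrite integral0_eq// => z _; rewrite /G indicE memNset ?mul0e// => Tz.
apply: Bw; apply/mem_set; apply: (measeq_measurable mA (Teq z Tz)).
by case: Tz.
Qed.

End conditioning.

(** * Almost sure uniqueness of conditional expectations *)

Section cond_exp_unique.
Context {d d'} {Om : measurableType d} {S : measurableType d'} {R : realType}
  (P : probability Om R) (Z : Om -> S).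
Hypothesis mZ : measurable_fun setT Z.

(** The event Y2 < Y1 is itself in the sigma-field of [Z], and both versions have the same integral
    over it. A strictly positive difference with integral 0 confines it to a null set. *)
Let cond_exp_le Y Y1 Y2 : is_cond_exp P Z Y Y1 -> is_cond_exp P Z Y Y2 ->
  {ae P, forall w, Y1 w <= Y2 w}.
Proof.
move=> [i1 m1 e1] [i2 m2 e2].
pose A := [set w | Y2 w < Y1 w].
have ZA : g_sigma_algebra_preimage Z A.
  have := measurable_fun_lte m2 m1 measurableT.
  by move=> /(_ [set true]); rewrite setTI; apply.
have mA : measurable A.
  by have [B mB <-] := ZA; exact: mZ.
have mT : measurable [set: Om] by [].
have j1 : P.-integrable A Y1 by exact: (integrableS mT).
have j2 : P.-integrable A Y2 by exact: (integrableS mT).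
have m12 : measurable_fun A (Y1 \- Y2).
  exact: emeasurable_funB (measurable_int P j1) (measurable_int P j2).
have /(ae_eq_integral_abs P mA m12) : \int[P]_(w in A) `|(Y1 \- Y2) w| = 0.
  rewrite -[RHS](subee (x := \int[P]_(w in A) Y w)); last first.
    by rewrite -e1//; exact: integrable_fin_num.
  rewrite -{1}e1// -e2// -integralB//; apply: eq_integral => w /set_mem Aw.
  by rewrite gee0_abs// ltW// sube_gt0.
apply: filterS => w h; rewrite leNgt; apply/negP => Aw.
by have := h Aw => /eqP; rewrite gt_eqF// sube_gt0.
Qed.

Lemma cond_exp_unique Y Y1 Y2 : is_cond_exp P Z Y Y1 -> is_cond_exp P Z Y Y2 ->
  {ae P, forall w, Y1 w = Y2 w}.
Proof.
move=> h1 h2; apply: filterS2 (cond_exp_le h1 h2) (cond_exp_le h2 h1) => w.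
by move=> h h'; apply/eqP; rewrite eq_le h h'.
Qed.

Lemma cond_exp_ae Y Y1 : is_cond_exp P Z Y Y1 ->
  {ae P, forall w, cond_exp P Z Y w = Y1 w}.
Proof.
move=> h1; apply: (@cond_exp_unique Y _ _ _ h1); rewrite /cond_exp.
by case: xgetP => [_ _ //|/(_ Y1)].
Qed.

End cond_exp_unique.

Theorem lemma4p4 (R : realType)
    (d : measure_display) (X : measurableType d) (hX : borel_space R X)
    (X0 : localising_ring X)
    (D : Nmeas X0 R -> Nmeas X0 R) (hD : generator D)
    (d' : measure_display) (Om : measurableType d') (P : probability Om R)
    (lambda : {measure set X -> \bar R}) (hlambda : locally_finite X0 lambda)
    (eta : Om -> Nmeas X0 R) (heta : poisson_process P lambda eta)
    (hmarkov : {ae P, forall w, D (eta w) setT < +oo} \/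
               strong_markov P D lambda eta)
    (f : X -> R) (hf : lambda.-integrable setT (EFin \o f)) :
  {ae P, forall w,
    cond_exp P (D \o eta) (fun w' => \int[eta w']_x (f x)%:E) w
      - \int[lambda]_x (f x)%:E
    = \int[eta w]_z (f z * Hind D z (subN (eta w) (diracN X0 R z)))%:E
      - \int[lambda]_z (f z * Hind D z (eta w))%:E}.
Proof.
clear hmarkov.
have mF := measurable_int _ hf; have mf : measurable_fun setT f by apply/measurable_EFinP.
pose F := EFin \o f.
have mZ : measurable_fun setT (D \o eta).
  exact: (measurableT_comp (generator_measurable hD) (poisson_process_measurable heta)).
pose V h w := cmean D lambda h (D (eta w)).
(* The Mecke equation for an integrand that ignores the configuration is Campbell's formula, which
   makes the mean finite. *)
have integral_fin h : lambda.-integrable setT h -> measurable_fun setT h ->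
    (forall x, 0 <= h x) -> \int[P]_w \int[eta w]_x h x < +oo.
  move=> ih mh h0.
  rewrite (mecke hX hlambda heta (G := fun p => h p.1))//; last first.
    exact: (measurableT_comp mh measurable_fst).
  rewrite (eq_integral (cst (\int[lambda]_z h z)))// integral_cst//.
  rewrite [X in _ * X](probability_setT P) mule1.
  by have /integrableP[_] := ih; under eq_integral do rewrite gee0_abs//.
have integrable_ge0 (h : Om -> \bar R) : measurable_fun setT h -> (forall w, 0 <= h w) ->
    \int[P]_w h w < +oo -> P.-integrable setT h.
  move=> mh h0 hfin; apply/integrableP; split => //.
  by under eq_integral do rewrite gee0_abs//.
have part h : lambda.-integrable setT h -> measurable_fun setT h ->
    (forall x, 0 <= h x) ->
    P.-integrable setT (V h) /\ P.-integrable setT (fun w => \int[eta w]_x h x).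
  move=> ih mh h0; split; apply: integrable_ge0.
  - exact: (measurableT_comp (measurable_cmean hX hD hlambda mh h0) mZ).
  - by move=> w; apply: adde_ge0; apply: integral_ge0 => // z _; apply: mule_ge0 => //;
      rewrite lee_fin; case/andP: (subr_Hind_itv D z (D (eta w))).
  - have := integral_cmean hX hD hlambda heta mh h0 measurableT.
    by rewrite preimage_setT => <-; exact: integral_fin.
  - apply: (@measurable_fun_integral_Nmeas _ _ _ _ _ _ eta (fun p => h p.2)) => //.
      exact: (poisson_process_measurable heta).
    exact: (measurableT_comp mh measurable_snd).
  - by move=> w; apply: integral_ge0.
  - exact: integral_fin.
have mT : measurable [set: X] by [].
have ip : lambda.-integrable setT F^\+ by exact: integrable_funepos.
have iN : lambda.-integrable setT F^\- by exact: integrable_funeneg.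
have mp : measurable_fun setT F^\+ by exact: measurable_funepos.
have mn : measurable_fun setT F^\- by exact: measurable_funeneg.
have [iVp iYp] := part _ ip mp (fun x => funepos_ge0 F x).
have [iVn iYn] := part _ iN mn (fun x => funeneg_ge0 F x).
have ce : is_cond_exp P (D \o eta) (fun w => \int[eta w]_x (f x)%:E)
    (V F^\+ \- V F^\-).
  split.
  - exact: integrableB.
  - have mZ' : measurable_fun [set: g_sigma_algebra_preimageType (D \o eta)]
        (D \o eta : g_sigma_algebra_preimageType (D \o eta) -> Nmeas X0 R).
      by move=> _ B mB; exists B.
    apply: emeasurable_funB.
    + exact: (measurableT_comp (measurable_cmean hX hD hlambda mp _) mZ').
    + exact: (measurableT_comp (measurable_cmean hX hD hlambda mn _) mZ').
  - move=> _ [B mB <-]; rewrite setTI.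
    have mZB : measurable ((D \o eta) @^-1` B) by rewrite -[_ @^-1` _]setTI; exact: mZ.
    under [RHS]eq_integral do rewrite integralE.
    rewrite integralB//; [|exact: (integrableS measurableT)..].
    rewrite integralB//; [|exact: (integrableS measurableT)..].
    by rewrite !(integral_cmean hX hD hlambda heta).
(* Integrability makes both parts of the version finite almost surely; only then may the extended
   real differences be rearranged. *)
apply: filterS3 (cond_exp_ae mZ ce) (integrable_ae measurableT iVp)
  (integrable_ae measurableT iVn) => w -> /(_ I) + /(_ I).
rewrite /V /cmean !fin_numD => /andP[ap ep] /andP[an en].
rewrite integral_Hind_subN// [X in _ = X - _]integralE.
have coH0 z : (0 <= 1 - Hind D z (D (eta w)) <= 1)%R by exact: subr_Hind_itv.
have mH : measurable_fun setT (fun z => Hind D z (D (eta w))).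
  exact: (measurableT_comp (measurable_fun_Hind hX hD) (measurable_pair2 _)).
have iH : lambda.-integrable setT (fun z => (f z * Hind D z (eta w))%:E).
  apply: (le_integrable measurableT _ _ hf).
    apply/measurable_EFinP/measurable_funM => //.
    by under eq_fun do rewrite (Hind_generator hX hD).
  move=> z _; rewrite /= lee_fin normrM ler_piMr//.
  by rewrite /Hind; case: asboolP => _; rewrite ?normr1 ?normr0.
have icoH h : lambda.-integrable setT h ->
    lambda.-integrable setT (fun z => (1 - Hind D z (D (eta w)))%:E * h z).
  move=> ih; apply: (le_integrable measurableT _ _ ih).
    apply: emeasurable_funM; last exact: measurable_int ih.
    by apply/measurable_EFinP; exact: measurable_funB.
  move=> z _; rewrite abseM gee0_abs ?lee_fin; last by case/andP: (coH0 z).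
  by rewrite gee_pMl// lee_fin; case/andP: (coH0 z).
(* F minus the hull term is the integral of (1 - H_z) f, written with the two parts of f as they
   occur in [cmean]. *)
have FH : \int[lambda]_x (f x)%:E - \int[lambda]_z (f z * Hind D z (eta w))%:E =
    \int[lambda]_z ((1 - Hind D z (D (eta w)))%:E * F^\+ z) -
    \int[lambda]_z ((1 - Hind D z (D (eta w)))%:E * F^\- z).
  rewrite -integralB// -integralB//; [|exact: icoH..].
  apply: eq_integral => z _.
  rewrite -muleBr//; last by rewrite /F funerpos funerneg.
  rewrite -[X in _ * X]/((F^\+ \- F^\-) z) -funeposneg.
  by rewrite /F /= -EFinB -EFinM (Hind_generator hX hD) mulrBl mul1r mulrC.
(* All six integrals are finite, so each is replaced by a real number and linear arithmetic
   remains. *)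
move: FH ap ep an en.
have : \int[lambda]_x (f x)%:E \is a fin_num by exact: (integrable_fin_num measurableT hf).
have : \int[lambda]_z (f z * Hind D z (eta w))%:E \is a fin_num.
  exact: (integrable_fin_num measurableT iH).
move: (\int[lambda]_z (f z * _)%:E) (\int[lambda]_x (f x)%:E).
move=> [b| |]// [a| |]// _ _.
move: (\int[lambda]_z (_ * F^\+ z)) (\int[lambda]_z (_ * F^\- z)).
move=> [ep| |] [en| |] // FH.
move: (\int[D (eta w)]_x F^\+ x) (\int[D (eta w)]_x F^\- x).
move=> [ap| |] // [an| |] // _ _ _ _.
move: FH; rewrite -!(EFinB, EFinD) => -[FH]; congr EFin.
have -> : b = (a - (ep - en))%R by rewrite -FH; ring.
ring.
Qed.
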